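(* Fix $m,n\ge1$ and $\omega_{mn}=\exp(2\pi\mathrm k\sqrt{-1}/mn)$ with $\mathrm{k}\in\mathbb Z$, $\gcd(\mathrm k,n)=1$, and put $\omega_n=\omega_{mn}^m$. Let $\Phi^{\omega_{mn}}_{m,n}\colon\widehat{\mathcal U}\to\widehat{\mathcal Y}$ be the homomorphism described in the context and $\bar\Phi^{\omega_{mn}}_{m,n}$ its reduction modulo $\hbar_2$. Under the identifications of the classical limits $\mathcal U/(\hbar_2)$ and $\mathcal Y/(\hbar_2)$ via $\theta^{(m)}$ and $\vartheta^{(mn)}$, the limit homomorphism $\bar\Phi^{\omega_{mn}}_{m,n}$ is induced by the Lie algebra homomorphism $\bar\Upsilon^{\omega_n}_{m,n}\colon\widehat{\bar{\mathfrak d}}^{(m)}_{\omega_n\exp(\hbar_1)}\to\widehat{\bar{\mathfrak D}}^{(mn)}_{\hbar_1}$; that is, $\vartheta^{(mn)}\circ\bar\Phi^{\omega_{mn}}_{m,n}=U(\bar\Upsilon^{\omega_n}_{m,n})\circ\theta^{(m)}$ on $\mathcal U/(\hbar_2)$.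
   Context: **Indices.** For $N\ge1$, $[N]=\{0,\dots,N-1\}$ is viewed as the set of residues mod $N$. $a^{(N)}_{i,j}$ is the Cartan matrix of type $A^{(1)}_{N-1}$ for $N\ge2$ (off-diagonal entries $-2$ for $N=2$) and $0$ for $N=1$. $m^{(N)}_{i,j}=1$ if $N>2,j=i-1$; $=-1$ if $N>2,j=i+1$; $=0$ otherwise. $\hbar_1,\hbar_2$ are formal variables, $\hbar_3:=-\hbar_1-\hbar_2$. $[a,b]_x:=ab-x\,ba$, $\{a,b\}:=ab+ba$, $\mathrm{Sym}$ is symmetrization over the indicated variables/indices, $[k]_q=\frac{q^k-q^{-k}}{q-q^{-1}}$, $\delta(z)=\sum_{k\in\mathbb Z}z^k$. $\equiv$ is congruence mod $m$. **Formal quantum toroidal algebra $\mathcal U=\mathcal U^{(m),\omega_{mn}}_{\hbar_1,\hbar_2}$.** Put $q_1=\omega_{mn}e^{\hbar_1/m}$, $q_2=e^{\hbar_2/m}$, $q_3=\omega_{mn}^{-1}e^{\hbar_3/m}$, $q=e^{\hbar_2/2m}$, $d=q_1q$. Let $d_{i,j}=d^{\mp1}$ if $m>2,j=i\pm1$; $-1$ if $m=2,j\ne i$; $1$ otherwise. Let $g_{i,j}(z,w)=z-q^{a_{i,j}}d^{-m_{i,j}}w$ if $m>2$; $z-q_2w$ if $m=2,i=j$; $(z-q_1w)(z-q_3w)$ if $m=2,i\neq j$; $(z-q_1w)(z-q_2w)(z-q_3w)$ if $m=1$ (here $a=a^{(m)}$, $m_{i,j}=m^{(m)}_{i,j}$).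 It is the unital associative $\mathbb C[[\hbar_1,\hbar_2]]$-algebra topologically generated by $e_{i,k},f_{i,k},h_{i,k}$ ($i\in[m],k\in\mathbb Z$) with relations, where $e_i(z)=\sum_k e_{i,k}z^{-k}$, $f_i(z)=\sum_kf_{i,k}z^{-k}$, $\psi_i^\pm(z)=\exp(\pm\frac{\hbar_2}{2m}h_{i,0})\exp(\pm(q-q^{-1})\sum_{r>0}h_{i,\pm r}z^{\mp r})$: - $[h_{i,k},h_{j,l}]=0$; - $[e_i(z),f_j(w)]=\frac{\delta_{i,j}}{q-q^{-1}}\delta(w/z)(\psi^+_i(w)-\psi^-_i(z))$; - $d_{i,j}g_{i,j}(z,w)e_i(z)e_j(w)=-g_{j,i}(w,z)e_j(w)e_i(z)$; - $d_{j,i}g_{j,i}(w,z)f_i(z)f_j(w)=-g_{i,j}(z,w)f_j(w)f_i(z)$; - $[h_{i,k},e_{j,l}]=b_m(i,j;k)e_{j,l+k}$, $[h_{i,k},f_{j,l}]=-b_m(i,j;k)f_{j,l+k}$, with $b_m(i,j;0)=a_{i,j}$ and for $k\ne0$: $b_m(i,j;k)=\frac{[ka_{i,j}]_q}{k}d^{-km_{i,j}}$ if $m>2$; $\frac{[2k]_q}{k}\delta_{j,i}-\frac{[k]_q}{k}(d^k+d^{-k})\delta_{j,i+1}$ if $m=2$; $\frac{[k]_q}{k}(q^k+q^{-k}-d^k-d^{-k})$ if $m=1$; - Serre relations, for $e$ and the same for $f$: if $m>2$: $[e_i(z),e_j(w)]=0$ when $a_{i,j}=0$, and $\mathrm{Sym}_{z_1,z_2}[e_i(z_1),[e_i(z_2),e_{i\pm1}(w)]_q]_{q^{-1}}=0$;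 if $m=2$: $\mathrm{Sym}_{z_1,z_2,z_3}[e_i(z_1),[e_i(z_2),[e_i(z_3),e_{i+1}(w)]_{q^2}]]_{q^{-2}}=0$; if $m=1$: $\mathrm{Sym}_{z_1,z_2,z_3}\frac{z_2}{z_3}[e_0(z_1),[e_0(z_2),e_0(z_3)]]=0$. **Formal affine Yangian $\mathcal Y=\mathcal Y^{(N)}_{\hbar_1,\hbar_2}$, $N=mn$.** Put $h_s=\hbar_s/N$, $\beta=(h_1-h_3)/2$, $\sigma_2=h_1h_2+h_1h_3+h_2h_3$, $\sigma_3=h_1h_2h_3$. It is the unital associative $\mathbb C[[\hbar_1,\hbar_2]]$-algebra topologically generated by $x^\pm_{i,r},\xi_{i,r}$ ($i\in[N],r\in\mathbb N=\{0,1,\dots\}$) with relations $[\xi_{i,r},\xi_{j,s}]=0$, $[x^+_{i,r},x^-_{j,s}]=\delta_{i,j}\xi_{i,r+s}$ and the following, where $y_{i,r}$ stands for $x^\pm_{i,r}$ and also for $\xi_{i,r}$: - $N>2$: $[y_{i,r+1},x^\pm_{j,s}]-[y_{i,r},x^\pm_{j,s+1}]=-m_{i,j}\beta[y_{i,r},x^\pm_{j,s}]\pm a_{i,j}\frac{h_2}{2}\{y_{i,r},x^\pm_{j,s}\}$; $[\xi_{i,0},x^\pm_{j,s}]=\pm a_{i,j}x^\pm_{j,s}$; $\mathrm{Sym}_{r_1,r_2}[x^\pm_{i,r_1},[x^\pm_{i,r_2},x^\pm_{i\pm1,s}]]=0$ (for both neighbours of $i$); $[x^\pm_{i,r},x^\pm_{j,s}]=0$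 if $a_{i,j}=0$. - $N=2$: $[y_{i,r+1},x^\pm_{i,s}]-[y_{i,r},x^\pm_{i,s+1}]=\pm h_2\{y_{i,r},x^\pm_{i,s}\}$; for $j\ne i$: $[y_{i,r+2},x^\pm_{j,s}]-2[y_{i,r+1},x^\pm_{j,s+1}]+[y_{i,r},x^\pm_{j,s+2}]=-h_1h_3[y_{i,r},x^\pm_{j,s}]\mp h_2(\{y_{i,r+1},x^\pm_{j,s}\}-\{y_{i,r},x^\pm_{j,s+1}\})$; $[\xi_{i,0},x^\pm_{j,s}]=\pm a_{i,j}x^\pm_{j,s}$; $[\xi_{i,1},x^\pm_{i+1,s}]=\mp(2x^\pm_{i+1,s+1}+h_2\{\xi_{i,0},x^\pm_{i+1,s}\})$; $\mathrm{Sym}_{r_1,r_2,r_3}[x^\pm_{i,r_1},[x^\pm_{i,r_2},[x^\pm_{i,r_3},x^\pm_{i+1,s}]]]=0$. - $N=1$: $[y_{0,r+3},x^\pm_{0,s}]-3[y_{0,r+2},x^\pm_{0,s+1}]+3[y_{0,r+1},x^\pm_{0,s+2}]-[y_{0,r},x^\pm_{0,s+3}]=-\sigma_2([y_{0,r+1},x^\pm_{0,s}]-[y_{0,r},x^\pm_{0,s+1}])\pm\sigma_3\{y_{0,r},x^\pm_{0,s}\}$; $[\xi_{0,0},x^\pm_{0,s}]=0=[\xi_{0,1},x^\pm_{0,s}]$, $[\xi_{0,2},x^\pm_{0,s}]=\pm2h_1h_3x^\pm_{0,s}$; $\mathrm{Sym}_{r_1,r_2,r_3}[x^\pm_{0,r_1},[x^\pm_{0,r_2},x^\pm_{0,r_3+1}]]=0$.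 It is $\mathbb N$-graded by $\deg x^\pm_{i,r}=\deg\xi_{i,r}=r$, $\deg\hbar_s=1$; $\widehat{\mathcal Y}$ is the completion with respect to this grading. **Matrix difference/differential operators.** For $Q\in\mathbb C[[\hbar_1]]^\times$, $\mathfrak d_Q$ is the $\mathbb C[[\hbar_1]]$-algebra topologically generated by $Z^{\pm1},D^{\pm1}$ with $DZ=Q\,ZD$; $\bar{\mathfrak d}^{(m)}_Q=\mathrm{Mat}_m\otimes\mathfrak d_Q\oplus\mathbb C[[\hbar_1]]c_{\mathfrak d}$ is the central extension of the commutator Lie algebra by $\phi(M_1\otimes D^{k_1}Z^{l_1},M_2\otimes D^{k_2}Z^{-l_2})=\delta_{l_1,l_2}\mathrm{tr}(M_1M_2)Q^{-l_1k_2}\frac{1-Q^{l_1(k_1+k_2)}}{1-Q^{k_1+k_2}}$ (fraction $=\frac{1-x^{l_1}}{1-x}$ at $x=Q^{k_1+k_2}$). $\mathfrak D_{\hbar_1}$ is the $\mathbb C[[\hbar_1]]$-algebra topologically generated by $\partial,x^{\pm1}$ with $\partial x=x(\partial+\hbar_1)$; $\bar{\mathfrak D}^{(N)}_{\hbar_1}=\mathrm{Mat}_N\otimes\mathfrak D_{\hbar_1}\oplus\mathbb C[[\hbar_1]]c_{\mathfrak D}$ is the central extension by $\phi(M_1\otimes f_1(\partial)x^k,M_2\otimes f_2(\partial)x^l)=\mathrm{tr}(M_1M_2)\sum_{a=0}^{k-1}f_1(a\hbar_1)f_2((a-k)\hbar_1)$ if $k=-l>0$, $-\mathrm{tr}(M_1M_2)\sum_{a=0}^{-k-1}f_2(a\hbar_1)f_1((a+k)\hbar_1)$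 if $k=-l<0$, $0$ otherwise. For $Q=\omega_n e^{\hbar_1}=q_1^m$, $\widehat{\bar{\mathfrak d}}^{(m)}_Q$ is the completion with respect to powers of $\mathrm{Mat}_m\otimes(D^n-1,\hbar_1)$ (i.e. the central extension of the completed matrix algebra), and $\widehat{\bar{\mathfrak D}}^{(N)}_{\hbar_1}$ the completion with respect to powers of $\mathrm{Mat}_N\otimes(\partial,\hbar_1)$. $\theta^{(m)}\colon\mathcal U/(\hbar_2)\to U(\bar{\mathfrak d}^{(m)}_{q_1^m})$: $e_{0,k}\mapsto E_{m,1}\otimes D^kZ$, $f_{0,k}\mapsto E_{1,m}\otimes Z^{-1}D^k$, $h_{0,k}\mapsto E_{m,m}\otimes D^k-E_{1,1}\otimes(q_1^mD)^k+c_{\mathfrak d}$, and for $i\ne0$: $e_{i,k}\mapsto E_{i,i+1}\otimes(q_1^{m-i}D)^k$, $f_{i,k}\mapsto E_{i+1,i}\otimes(q_1^{m-i}D)^k$, $h_{i,k}\mapsto(E_{i,i}-E_{i+1,i+1})\otimes(q_1^{m-i}D)^k$. $\vartheta^{(N)}\colon\mathcal Y/(\hbar_2)\to U(\bar{\mathfrak D}^{(N)}_{\hbar_1})$: $x^+_{0,r}\mapsto E_{N,1}\otimes\partial^rx$, $x^-_{0,r}\mapsto E_{1,N}\otimes x^{-1}\partial^r$, $\xi_{0,r}\mapsto E_{N,N}\otimes\partial^r-E_{1,1}\otimes(\partial+\hbar_1)^r+\delta_{0,r}c_{\mathfrak D}$, and for $i\ne0$: $x^+_{i,r}\mapsto E_{i,i+1}\otimes(\partial+(1-\frac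 iN)\hbar_1)^r$, $x^-_{i,r}\mapsto E_{i+1,i}\otimes(\partial+(1-\frac iN)\hbar_1)^r$, $\xi_{i,r}\mapsto(E_{i,i}-E_{i+1,i+1})\otimes(\partial+(1-\frac iN)\hbar_1)^r$; it is extended to $\widehat{\mathcal Y}/(\hbar_2)$ with values in the completion of $U(\bar{\mathfrak D}^{(N)}_{\hbar_1})$ for the grading $\deg\partial=\deg\hbar_1=1$, $\deg x=\deg c_{\mathfrak D}=\deg E_{a,b}=0$. $\bar\Upsilon^{\omega_n}_{m,n}\colon\widehat{\bar{\mathfrak d}}^{(m)}_{\omega_ne^{\hbar_1}}\to\widehat{\bar{\mathfrak D}}^{(mn)}_{\hbar_1}$ is the Lie algebra homomorphism with $c_{\mathfrak d}\mapsto c_{\mathfrak D}$ and, on $\mathrm{Mat}_m\otimes\mathfrak d_Q$, induced by $D\mapsto\sum_{a=1}^nE_{a,a}\otimes Q^{n-a}e^{n\partial}$, $Z\mapsto\sum_{a=1}^{n-1}E_{a,a+1}+E_{n,1}\otimes x$ ($Q=\omega_ne^{\hbar_1}$) and $\mathrm{Mat}_m\otimes\mathrm{Mat}_n\simeq\mathrm{Mat}_{mn}$, $E_{a,b}\otimes E_{k,l}\mapsto E_{m(k-1)+a,m(l-1)+b}$. **The homomorphism $\Phi^{\omega_{mn}}_{m,n}$.** $\widehat{\mathcal U}=\varprojlim_r\mathcal U/\mathfrak J^r$, where $\mathfrak J$ is the kernel of $\mathcal U\to\mathcal U/(\hbar_2)\xrightarrow{\theta^{(m)}}U(\bar{\mathfrak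 d}^{(m)}_{q_1^m})\to U(\bar{\mathfrak d}^{(m)}_{q_1^m}/\mathrm{Mat}_m\otimes(D^n-1,\hbar_1))$ (the last quotient being the central extension of the quotient matrix algebra by the cocycle reduced mod $\hbar_1$). For $i'\in[mn]$: $\xi_{i'}(z)=1+\frac{\hbar_2}{mn}\sum_{r\ge0}\xi_{i',r}z^{-r-1}$; $\log\xi_{i'}(z)=\sum_{r\ge0}t_{i',r}z^{-r-1}$; $B_{i'}(w)=\sum_{r\ge0}\frac{t_{i',r}}{r!}w^r$. For $i'\equiv j'$: $H_{i',j'}(v)=\frac{nv}{e^{nv/2}-e^{-nv/2}}$ if $i'=j'$, $\frac{\omega_{mn}^{-i'}-\omega_{mn}^{-j'}}{\omega_{mn}^{-i'}e^{nv/2}-\omega_{mn}^{-j'}e^{-nv/2}}$ if $i'\ne j'$; $G_{i',j'}=\log H_{i',j'}$; $\gamma_{i',j'}(v)=-B_{j'}(-\partial_v)\partial_vG_{i',j'}(v)$; $g_{i'}(v)=\big(\frac{\hbar_2}{m(q-q^{-1})}\big)^{1/2}\exp\big(\frac12\sum_{j'\equiv i'}\gamma_{i',j'}(v)\big)$. Writing $e^{knv}g_{i'}(v)=\sum_rg^{(k)}_{i',r}v^r$, $\Phi^{\omega_{mn}}_{m,n}$ is the $\mathbb C[[\hbar_1,\hbar_2]]$-algebra homomorphism with $h_{i,0}\mapsto\sum_{i'\equiv i}\xi_{i',0}$, $h_{i,l}\mapsto\frac n{q-q^{-1}}\sum_{i'\equiv i}\omega_{mn}^{-li'}B_{i'}(ln)$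 ($l\ne0$), $e_{i,k}\mapsto\sum_{i'\equiv i}\omega_{mn}^{-ki'}\sum_{r\geq 0}g^{(k)}_{i',r}x^+_{i',r}$, $f_{i,k}\mapsto\sum_{i'\equiv i}\omega_{mn}^{-ki'}\sum_{r\geq 0}g^{(k)}_{i',r}x^-_{i',r}$ (sums over $i'\in[mn]$). *)

(* Defs.v *)
From HB Require Import structures.
From mathcomp Require Import all_boot all_order all_algebra.
From mathcomp Require Import complex.
From mathcomp Require Import boolp classical_sets reals trigo.
From mathcomp Require Import monalg.

Set Implicit Arguments.
Unset Strict Implicit.
Unset Printing Implicit Defensive.

Import Order.TTheory GRing.Theory Num.Theory.
Local Open Scope ring_scope.

(** * Formal power series in one central variable, over an arbitrary ring *)

Record fps (A : Type) := FPS { fco : nat -> A }.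

Lemma fpsP (A : Type) (u v : fps A) : (forall i, fco u i = fco v i) -> u = v.
Proof.
by case: u => u; case: v => v /= uv; congr FPS; apply/functional_extensionality_dep.
Qed.

HB.instance Definition _ (A : Type) := gen_eqMixin (fps A).
HB.instance Definition _ (A : Type) := gen_choiceMixin (fps A).

(* the operations below are locked, to prevent unification from unfolding them *)
Fact alg_key : unit. Proof. by []. Qed.

Section FpsZmod.
Variable A : zmodType.
Implicit Types u v w : fps A.

Definition fps_zero : fps A := FPS (fun _ => 0).
Definition fps_add :=
  locked_with alg_key (fun u v => FPS (fun i => fco u i + fco v i)).
Definition fps_opp := locked_with alg_key (fun u => FPS (fun i => - fco u i)).

Fact fco_add u v i : fco (fps_add u v) i = fco u i + fco v i.
Proof. by rewrite /fps_add locked_withE. Qed.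
Fact fco_opp u i : fco (fps_opp u) i = - fco u i.
Proof. by rewrite /fps_opp locked_withE. Qed.

Fact fps_addA : associative fps_add.
Proof. by move=> u v w; apply: fpsP => i; rewrite !fco_add addrA. Qed.
Fact fps_addC : commutative fps_add.
Proof. by move=> u v; apply: fpsP => i; rewrite !fco_add addrC. Qed.
Fact fps_add0 : left_id fps_zero fps_add.
Proof. by move=> u; apply: fpsP => i; rewrite fco_add add0r. Qed.
Fact fps_addN : left_inverse fps_zero fps_opp fps_add.
Proof. by move=> u; apply: fpsP => i; rewrite fco_add fco_opp addNr. Qed.

HB.instance Definition _ :=
  GRing.isZmodule.Build (fps A) fps_addA fps_addC fps_add0 fps_addN.

Lemma fcoD u v i : fco (u + v) i = fco u i + fco v i. Proof. exact: fco_add. Qed.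
Lemma fcoN u i : fco (- u) i = - fco u i. Proof. exact: fco_opp. Qed.
Lemma fco0 i : fco (0 : fps A) i = 0. Proof. by []. Qed.

Definition fcst (a : A) : fps A := FPS (fun i => if i == 0%N then a else 0).

End FpsZmod.

Section FpsRing.
Variable A : pzRingType.
Implicit Types u v w : fps A.

Definition fps_one : fps A := fcst 1.
Definition fps_mul := locked_with alg_key
  (fun u v => FPS (fun i => \sum_(j < i.+1) fco u j * fco v (i - j))).

Fact fco_mul u v i :
  fco (fps_mul u v) i = \sum_(j < i.+1) fco u j * fco v (i - j).
Proof. by rewrite /fps_mul locked_withE. Qed.

Fact fco_mul_rev u v i :
  fco (fps_mul u v) i = \sum_(j < i.+1) fco u (i - j) * fco v j.
Proof.
rewrite fco_mul (reindex_inj rev_ord_inj) /=.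
by apply: eq_bigr => j _; rewrite (sub_ordK j).
Qed.

Fact fps_mulA : associative fps_mul.
Proof.
move=> p q r; apply: fpsP => i; rewrite fco_mul [RHS]fco_mul_rev.
pose coef3 j k := fco p j * (fco q (i - j - k) * fco r k).
transitivity (\sum_(j < i.+1) \sum_(k < i.+1 | (k <= i - j)%N) coef3 j k).
  apply: eq_bigr => j _; rewrite fco_mul_rev big_distrr /=.
  by rewrite (big_ord_narrow_leq (leq_subr _ _)).
rewrite (exchange_big_dep predT) //; apply: eq_bigr => k _.
transitivity (\sum_(j < i.+1 | (j <= i - k)%N) coef3 j k).
  apply: eq_bigl => j; rewrite -ltnS -(ltnS j) -!subSn ?leq_ord //.
  by rewrite -subn_gt0 -(subn_gt0 j) -!subnDA addnC.
rewrite (big_ord_narrow_leq (leq_subr _ _)) fco_mul big_distrl /=.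
by apply: eq_bigr => j _; rewrite /coef3 -!subnDA addnC mulrA.
Qed.

Fact fps_mul1l : left_id fps_one fps_mul.
Proof.
move=> p; apply: fpsP => i; rewrite fco_mul big_ord_recl /= mul1r subn0.
by rewrite big1 ?addr0 // => j _; rewrite mul0r.
Qed.

Fact fps_mul1r : right_id fps_one fps_mul.
Proof.
move=> p; apply: fpsP => i; rewrite fco_mul_rev big_ord_recl /= mulr1 subn0.
by rewrite big1 ?addr0 // => j _; rewrite mulr0.
Qed.

Fact fps_mulDl : left_distributive fps_mul +%R.
Proof.
move=> p q r; apply: fpsP => i; rewrite fcoD !fco_mul -big_split /=.
by apply: eq_bigr => j _; rewrite fcoD mulrDl.
Qed.

Fact fps_mulDr : right_distributive fps_mul +%R.
Proof.
move=> p q r; apply: fpsP => i; rewrite fcoD !fco_mul -big_split /=.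
by apply: eq_bigr => j _; rewrite fcoD mulrDr.
Qed.

HB.instance Definition _ := GRing.Zmodule_isPzRing.Build (fps A)
  fps_mulA fps_mul1l fps_mul1r fps_mulDl fps_mulDr.

Lemma fcoM u v i : fco (u * v) i = \sum_(j < i.+1) fco u j * fco v (i - j).
Proof. exact: fco_mul. Qed.

Definition fX : fps A := FPS (fun i => (i == 1%N)%:R).

Definition fderiv u : fps A := FPS (fun i => fco u i.+1 *+ i.+1).

(* [fcomp p u] is the substituted series [\sum_j p_j u^j]; it has this meaning
   only for [u] without constant term, when [u^j] starts in degree [j] or more *)
Definition fcomp (p : nat -> A) u : fps A :=
  FPS (fun i => \sum_(j < i.+1) p j * fco (u ^+ j) i).

End FpsRing.

Arguments fX {A}.

Section FpsNz.
Variable A : nzRingType.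
Fact fps_one_neq0 : (1 : fps A) != 0.
Proof. by apply/eqP => /(congr1 (fun u => fco u 0)) /eqP; rewrite oner_eq0. Qed.
HB.instance Definition _ := GRing.PzSemiRing_isNonZero.Build (fps A) fps_one_neq0.
End FpsNz.

Section FpsCom.
Variable A : comPzRingType.
Fact fps_mulC : @commutative (fps A) _ *%R.
Proof.
move=> u v; apply: fpsP => i; rewrite [RHS]fco_mul_rev fcoM.
by apply: eq_bigr => j _; rewrite mulrC.
Qed.
HB.instance Definition _ := GRing.PzRing_hasCommutativeMul.Build (fps A) fps_mulC.
End FpsCom.

HB.instance Definition _ (A : comNzRingType) := GRing.ComPzRing.on (fps A).

(** * Algebras over a commutative ring

The library's [algType] excludes the zero ring, whereas a quotient by an
arbitrary ideal may be zero. An algebra over [S] is therefore taken to be a ring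
with a central ring homomorphism [csc] from [S]. *)

HB.mixin Record PzRing_isCAlg (S : comPzRingType) A of GRing.PzRing A := {
  csc : S -> A;
  csc_is_zmod_morphism : zmod_morphism csc;
  csc_is_monoid_morphism : monoid_morphism csc;
  csc_central : forall s a, csc s * a = a * csc s
}.

#[short(type="calgType")]
HB.structure Definition CAlg (S : comPzRingType) :=
  {A of GRing.PzRing A & PzRing_isCAlg S A}.

Arguments csc {S s} _ : rename.

Section CscMorphism.
Variables (S : comPzRingType) (A : calgType S).
HB.instance Definition _ :=
  GRing.isZmodMorphism.Build S A (@csc S A) csc_is_zmod_morphism.
HB.instance Definition _ :=
  GRing.isMonoidMorphism.Build S A (@csc S A) csc_is_monoid_morphism.
End CscMorphism.

Definition cscale (S : comPzRingType) (A : calgType S) (s : S) (a : A) : A :=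
  csc s * a.
Notation "s *! a" := (cscale s a) (at level 40, left associativity) : ring_scope.

Definition is_alghom (S : comPzRingType) (A B : calgType S)
  (f : {rmorphism A -> B}) : Prop := forall s : S, f (csc s) = csc s.

(** * Two-sided ideals and quotient rings *)

Section Quotient.
Variable A : pzRingType.
Implicit Types J I : set A.

Definition is_ideal I : Prop :=
  [/\ I 0, (forall x y, I x -> I y -> I (x - y)),
      (forall a x, I x -> I (a * x)) & (forall a x, I x -> I (x * a))].

Definition ideal_gen J : set A :=
  [set x | forall I, is_ideal I -> (J `<=` I)%classic -> I x].

Lemma ideal_gen_ideal J : is_ideal (ideal_gen J).
Proof.
split=> [I []//|x y hx hy I hI hJ|a x hx I hI hJ|a x hx I hI hJ];
  case: (hI) => I0 IB IL IR.
- by apply: (IB); [exact: hx | exact: hy].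
- by apply: (IL); exact: hx.
- by apply: (IR); exact: hx.
Qed.

Lemma sub_ideal_gen J : (J `<=` ideal_gen J)%classic.
Proof. by move=> x Jx I _; apply. Qed.

Variable J : set A.

Definition qequiv : rel A := fun x y => `[< ideal_gen J (x - y) >].

Fact qequiv_is_equiv : equiv_class_of qequiv.
Proof.
case: (ideal_gen_ideal J) => I0 IB IL IR; split=> [x|x y|y x z].
- by apply/asboolP; rewrite subrr.
- by apply/asboolP/asboolP => h; rewrite -opprB -[- _]add0r; apply: (IB).
- move=> /asboolP xy /asboolP yz; apply/asboolP.
  rewrite (_ : x - z = (x - y) - (0 - (y - z))); last first.
    by rewrite sub0r opprK addrA subrK.
  by apply: (IB _ _ xy); apply: (IB).
Qed.
Canonical qequiv_equiv := EquivRelPack qequiv_is_equiv.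
Canonical qequiv_encModRel := defaultEncModRel qequiv.

(* the quotient of [A] by the two-sided ideal generated by [J] *)
Definition quot := {eq_quot qequiv}%qT.

HB.instance Definition _ := EqQuotient.on quot.
HB.instance Definition _ := Choice.on quot.

Definition qpi : A -> quot := locked_with alg_key (fun x => (\pi_quot x)%qT).
Definition qrepr (x : quot) : A := repr x.

Lemma qreprK : cancel qrepr qpi.
Proof. by rewrite /qpi locked_withE; exact: reprK. Qed.

Lemma qpiP x y : qpi x = qpi y <-> ideal_gen J (x - y).
Proof.
rewrite /qpi locked_withE.
split=> [/eqmodP /asboolP //|h]; apply/eqmodP; exact/asboolP.
Qed.

Lemma qrepr_pi x : ideal_gen J (qrepr (qpi x) - x).
Proof. by apply/qpiP; rewrite qreprK. Qed.

Definition quot_add := locked_with alg_key (fun x y => qpi (qrepr x + qrepr y)).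
Definition quot_opp := locked_with alg_key (fun x => qpi (- qrepr x)).
Definition quot_mul := locked_with alg_key (fun x y => qpi (qrepr x * qrepr y)).

Let piD x y : quot_add (qpi x) (qpi y) = qpi (x + y).
Proof.
rewrite /quot_add locked_withE.
case: (ideal_gen_ideal J) => I0 IB IL IR; apply/qpiP.
rewrite opprD addrACA -[qrepr (qpi y) - y]opprK; apply: (IB); first exact: qrepr_pi.
by rewrite -[- _]add0r; apply: (IB) => //; exact: qrepr_pi.
Qed.
Let piN x : quot_opp (qpi x) = qpi (- x).
Proof.
rewrite /quot_opp locked_withE.
case: (ideal_gen_ideal J) => I0 IB IL IR; apply/qpiP.
by rewrite -opprD -[- _]add0r; apply: (IB) => //; exact: qrepr_pi.
Qed.
Let piM x y : quot_mul (qpi x) (qpi y) = qpi (x * y).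
Proof.
rewrite /quot_mul locked_withE.
case: (ideal_gen_ideal J) => I0 IB IL IR; apply/qpiP.
rewrite (_ : _ - _ = (qrepr (qpi x) - x) * qrepr (qpi y)
   - (0 - x * (qrepr (qpi y) - y))); last first.
  by rewrite mulrBl mulrBr sub0r opprK addrA subrK.
by apply: (IB); [apply: (IR)|apply: (IB) => //; apply: (IL)]; exact: qrepr_pi.
Qed.

Let quotE (P : quot -> Prop) : (forall x, P (qpi x)) -> forall x, P x.
Proof. by move=> h x; rewrite -[x]qreprK. Qed.

Fact quot_addA : associative quot_add.
Proof.
by elim/quotE=> x; elim/quotE=> y; elim/quotE=> z; rewrite !piD addrA.
Qed.
Fact quot_addC : commutative quot_add.
Proof. by elim/quotE=> x; elim/quotE=> y; rewrite !piD addrC. Qed.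
Fact quot_add0 : left_id (qpi 0) quot_add.
Proof. by elim/quotE=> x; rewrite !piD add0r. Qed.
Fact quot_addN : left_inverse (qpi 0) quot_opp quot_add.
Proof. by elim/quotE=> x; rewrite piN piD addNr. Qed.

HB.instance Definition _ :=
  GRing.isZmodule.Build quot quot_addA quot_addC quot_add0 quot_addN.

Fact quot_mulA : associative quot_mul.
Proof.
by elim/quotE=> x; elim/quotE=> y; elim/quotE=> z; rewrite !piM mulrA.
Qed.
Fact quot_mul1l : left_id (qpi 1) quot_mul.
Proof. by elim/quotE=> x; rewrite piM mul1r. Qed.
Fact quot_mul1r : right_id (qpi 1) quot_mul.
Proof. by elim/quotE=> x; rewrite piM mulr1. Qed.
Fact quot_mulDl : left_distributive quot_mul quot_add.
Proof.
elim/quotE=> x; elim/quotE=> y; elim/quotE=> z.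
by rewrite !(piD, piM) mulrDl.
Qed.
Fact quot_mulDr : right_distributive quot_mul quot_add.
Proof.
elim/quotE=> x; elim/quotE=> y; elim/quotE=> z.
by rewrite !(piD, piM) mulrDr.
Qed.

HB.instance Definition _ := GRing.Zmodule_isPzRing.Build quot
  quot_mulA quot_mul1l quot_mul1r quot_mulDl quot_mulDr.

Fact qpi_is_zmod_morphism : zmod_morphism qpi.
Proof.
by move=> x y; rewrite -[RHS]/(quot_add (qpi x) (quot_opp (qpi y))) piN piD.
Qed.
Fact qpi_is_monoid_morphism : monoid_morphism qpi.
Proof. by split=> // x y; rewrite -piM. Qed.

HB.instance Definition _ :=
  GRing.isZmodMorphism.Build A quot qpi qpi_is_zmod_morphism.
HB.instance Definition _ :=
  GRing.isMonoidMorphism.Build A quot qpi qpi_is_monoid_morphism.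

End Quotient.

Section QuotCAlg.
Variables (S : comPzRingType) (A : calgType S) (J : set A).
Definition quot_csc (s : S) : quot J := qpi J (csc s).
Fact quot_csc_zmod : zmod_morphism quot_csc.
Proof. by move=> s t; rewrite /quot_csc !rmorphB. Qed.
Fact quot_csc_monoid : monoid_morphism quot_csc.
Proof. by split=> [|s t]; rewrite /quot_csc ?rmorph1 // !rmorphM. Qed.
Fact quot_csc_central s a : quot_csc s * a = a * quot_csc s.
Proof. by rewrite -[a]qreprK -!rmorphM csc_central. Qed.
HB.instance Definition _ := PzRing_isCAlg.Build S (quot J)
  quot_csc_zmod quot_csc_monoid quot_csc_central.
End QuotCAlg.

(* the map between quotients induced by [f]; it is well defined
   when [f] maps the ideal generated by [J] into the one generated by [K] *)
Definition qmap (A B : pzRingType) (J : set A) (K : set B) (f : A -> B)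
  (x : quot J) : quot K := qpi K (f (qrepr x)).
Arguments qmap {A B J K} f x.

(* the [r]-th power of the ideal generated by [J]: the products of [r] of its
   elements generate it as an ideal *)
Definition ideal_pow (A : pzRingType) (J : set A) (r : nat) : set A :=
  [set x | exists s : r.-tuple A,
     (forall i, ideal_gen J (tnth s i)) /\ x = \prod_(y <- s) y].

(** * Completions *)

Section Completion.
Variables (A : pzRingType) (J : nat -> set A).

(* the inverse limit of the quotients [quot (J p)], for decreasing [J] *)
Definition compatible (u : forall p, quot (J p)) : Prop :=
  forall p r, (p <= r)%N ->
  exists x : A, u p = qpi (J p) x /\ u r = qpi (J r) x.

Record compl := Compl {
  cproj : forall p, quot (J p);
  cproj_compatible : compatible cproj }.

HB.instance Definition _ := gen_eqMixin compl.
HB.instance Definition _ := gen_choiceMixin compl.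

Lemma complP (u v : compl) : (forall p, cproj u p = cproj v p) -> u = v.
Proof.
case: u v => u hu [v hv] /= uv.
have E : u = v by apply: functional_extensionality_dep.
by rewrite {}E in hu *; congr Compl; exact: Prop_irrelevance.
Qed.

Fact cin_compatible x : compatible (fun p => qpi (J p) x).
Proof. by move=> p r _; exists x. Qed.
Definition cin : A -> compl :=
  locked_with alg_key (fun x => Compl (cin_compatible x)).
Lemma cproj_cin x p : cproj (cin x) p = qpi (J p) x.
Proof. by rewrite /cin locked_withE. Qed.

Fact compl_add_compatible (u v : compl) :
  compatible (fun p => cproj u p + cproj v p).
Proof.
move=> p r pr; case: (cproj_compatible u pr) => x [-> ->].
case: (cproj_compatible v pr) => y [-> ->].
by exists (x + y); rewrite !rmorphD.
Qed.
Fact compl_opp_compatible (u : compl) : compatible (fun p => - cproj u p).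
Proof.
move=> p r pr; case: (cproj_compatible u pr) => x [-> ->].
by exists (- x); rewrite !rmorphN.
Qed.
Fact compl_mul_compatible (u v : compl) :
  compatible (fun p => cproj u p * cproj v p).
Proof.
move=> p r pr; case: (cproj_compatible u pr) => x [-> ->].
case: (cproj_compatible v pr) => y [-> ->].
by exists (x * y); rewrite !rmorphM.
Qed.

Definition compl_add :=
  locked_with alg_key (fun u v => Compl (compl_add_compatible u v)).
Definition compl_opp :=
  locked_with alg_key (fun u => Compl (compl_opp_compatible u)).
Definition compl_mul :=
  locked_with alg_key (fun u v => Compl (compl_mul_compatible u v)).

Fact cproj_add u v p : cproj (compl_add u v) p = cproj u p + cproj v p.
Proof. by rewrite /compl_add locked_withE. Qed.
Fact cproj_opp u p : cproj (compl_opp u) p = - cproj u p.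
Proof. by rewrite /compl_opp locked_withE. Qed.
Fact cproj_mul u v p : cproj (compl_mul u v) p = cproj u p * cproj v p.
Proof. by rewrite /compl_mul locked_withE. Qed.

Let cprojE := (cproj_add, cproj_opp, cproj_mul, cproj_cin).

Fact compl_addA : associative compl_add.
Proof. by move=> u v w; apply: complP => p; rewrite !cprojE addrA. Qed.
Fact compl_addC : commutative compl_add.
Proof. by move=> u v; apply: complP => p; rewrite !cprojE addrC. Qed.
Fact compl_add0 : left_id (cin 0) compl_add.
Proof. by move=> u; apply: complP => p; rewrite !cprojE rmorph0 add0r. Qed.
Fact compl_addN : left_inverse (cin 0) compl_opp compl_add.
Proof. by move=> u; apply: complP => p; rewrite !cprojE rmorph0 addNr. Qed.

HB.instance Definition _ :=
  GRing.isZmodule.Build compl compl_addA compl_addC compl_add0 compl_addN.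

Fact compl_mulA : associative compl_mul.
Proof. by move=> u v w; apply: complP => p; rewrite !cprojE mulrA. Qed.
Fact compl_mul1l : left_id (cin 1) compl_mul.
Proof. by move=> u; apply: complP => p; rewrite !cprojE rmorph1 mul1r. Qed.
Fact compl_mul1r : right_id (cin 1) compl_mul.
Proof. by move=> u; apply: complP => p; rewrite !cprojE rmorph1 mulr1. Qed.
Fact compl_mulDl : left_distributive compl_mul +%R.
Proof. by move=> u v w; apply: complP => p; rewrite !cprojE mulrDl. Qed.
Fact compl_mulDr : right_distributive compl_mul +%R.
Proof. by move=> u v w; apply: complP => p; rewrite !cprojE mulrDr. Qed.

HB.instance Definition _ := GRing.Zmodule_isPzRing.Build compl
  compl_mulA compl_mul1l compl_mul1r compl_mulDl compl_mulDr.

Lemma cprojD u v p : cproj (u + v) p = cproj u p + cproj v p.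
Proof. exact: cproj_add. Qed.
Lemma cprojN u p : cproj (- u) p = - cproj u p.
Proof. exact: cproj_opp. Qed.
Lemma cprojM u v p : cproj (u * v) p = cproj u p * cproj v p.
Proof. exact: cproj_mul. Qed.
Lemma cproj0 p : cproj 0 p = 0. Proof. by rewrite cproj_cin rmorph0. Qed.
Lemma cproj1 p : cproj 1 p = 1. Proof. by rewrite cproj_cin rmorph1. Qed.

Fact cin_is_zmod_morphism : zmod_morphism cin.
Proof.
move=> x y; apply: complP => p.
by rewrite cprojD cprojN !cproj_cin rmorphB.
Qed.
Fact cin_is_monoid_morphism : monoid_morphism cin.
Proof.
by split=> // x y; apply: complP => p; rewrite cprojM !cproj_cin; exact: rmorphM.
Qed.
HB.instance Definition _ :=
  GRing.isZmodMorphism.Build A compl cin cin_is_zmod_morphism.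
HB.instance Definition _ :=
  GRing.isMonoidMorphism.Build A compl cin cin_is_monoid_morphism.

(* [\sum_i f i] for the inverse limit topology, and [0] if this diverges *)
Definition converges_to (f : nat -> compl) (s : compl) : Prop :=
  forall p, exists n0, forall n, (n0 <= n)%N ->
  cproj (\sum_(i < n) f i) p = cproj s p.
Definition csum (f : nat -> compl) : compl := xget 0 [set s | converges_to f s].

End Completion.

Section ComplCAlg.
Variables (S : comPzRingType) (A : calgType S) (J : nat -> set A).
Definition compl_csc (s : S) : compl J := cin J (csc s).
Fact compl_csc_zmod : zmod_morphism compl_csc.
Proof. by move=> s t; rewrite /compl_csc !rmorphB. Qed.
Fact compl_csc_monoid : monoid_morphism compl_csc.
Proof. by split=> [|s t]; rewrite /compl_csc ?rmorph1 // !rmorphM. Qed.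
Fact compl_csc_central s a : compl_csc s * a = a * compl_csc s.
Proof.
apply: complP => p; rewrite !cprojM cproj_cin -[cproj a p]qreprK.
by rewrite -!rmorphM csc_central.
Qed.
HB.instance Definition _ := PzRing_isCAlg.Build S (compl J)
  compl_csc_zmod compl_csc_monoid compl_csc_central.
End ComplCAlg.

Section FpsMap.
Variables (A B : pzRingType) (f : {rmorphism A -> B}).
Definition fps_map (u : fps A) : fps B := FPS (fun i => f (fco u i)).
Fact fps_map_is_zmod_morphism : zmod_morphism fps_map.
Proof. by move=> u v; apply: fpsP => i; rewrite /= !(fcoD, fcoN) rmorphB. Qed.
Fact fps_map_is_monoid_morphism : monoid_morphism fps_map.
Proof.
split=> [|u v]; apply: fpsP => i.
  by rewrite /=; case: (i == 0%N); rewrite ?rmorph1 ?rmorph0.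
by rewrite /= !fcoM rmorph_sum; apply: eq_bigr => j _; rewrite rmorphM.
Qed.
HB.instance Definition _ := GRing.isZmodMorphism.Build (fps A) (fps B) fps_map
  fps_map_is_zmod_morphism.
HB.instance Definition _ := GRing.isMonoidMorphism.Build (fps A) (fps B) fps_map
  fps_map_is_monoid_morphism.
Lemma fps_map_central : (forall a b, f a * b = b * f a) ->
  forall u v, fps_map u * v = v * fps_map u.
Proof.
move=> fC u v; apply: fpsP => i; rewrite [RHS]fco_mul_rev fcoM.
by apply: eq_bigr => j _; rewrite /= fC.
Qed.
End FpsMap.

(** * The ground ring C[[hbar_1, hbar_2]]

Series in [hbar_2] whose coefficients are series in [hbar_1]. An algebra over
[C[[hbar_1]]] is treated as an algebra over [C[[hbar_1, hbar_2]]] in which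
[hbar_2 = 0]. *)

Section GroundRing.
Variable R : realType.
Local Notation C := (R[i]%C).

Definition Ch1 := fps C.
Definition Ch := fps Ch1.
HB.instance Definition _ := GRing.ComNzRing.on Ch1.
HB.instance Definition _ := GRing.ComNzRing.on Ch.

Definition cC (c : C) : Ch := fcst (fcst c).
Definition hbar1 : Ch := fcst fX.
Definition hbar2 : Ch := fX.
Definition hbar3 : Ch := - hbar1 - hbar2.
(* [exp (a hbar_1 + b hbar_2)] *)
Definition hexp (a b : C) : Ch :=
  FPS (fun j => FPS (fun i => a ^+ i / (i`!)%:R * (b ^+ j / (j`!)%:R))).
(* reduction modulo [hbar_2] *)
Definition red2 (s : Ch) : Ch1 := fco s 0.

Definition expi (t : R) : C := (cos t +i* sin t)%C.
(* [omega_{mn}]; the integer [k] is the one in [exp (2 pi k sqrt(-1) / mn)] *)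
Definition omega (m n : nat) (k : int) : C :=
  expi (2 * pi * k%:~R / (m * n)%:R).
Definition omega_n (m n : nat) (k : int) : C := omega m n k ^+ m.

(* Quotient [a / b] in a ring without zero divisors, where [b] divides [a] *)
Definition fquot (T : pzRingType) (a b : T) : T := xget 0 [set c | c * b = a].

(* Coefficients of [exp t], [log (1 + t)] and [(1 + t)^(1/2)] *)
Definition exp_co (j : nat) : C := (j`!)%:R^-1.
Definition log1p_co (j : nat) : C := if j is j'.+1 then (-1) ^+ j' / j%:R else 0.
Definition sqrt1p_co (j : nat) : C :=
  (\prod_(l < j) (2^-1 - l%:R)) / (j`!)%:R.

End GroundRing.

Arguments hbar1 {R}.
Arguments hbar2 {R}.
Arguments hbar3 {R}.
Arguments exp_co {R} j.
Arguments log1p_co {R} j.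
Arguments sqrt1p_co {R} j.

(** * Topologically presented algebras *)

Lemma malgC_central (K : monomType) (A : comNzRingType) (c : A) (g : {malg A[K]}) :
  c%:MP * g = g * c%:MP.
Proof.
rewrite [LHS]malgM_def [RHS]malgM_def fgmulUg fgmulgU.
by apply: eq_bigr => k _; rewrite mul1m mulm1 mulrC.
Qed.

Section Presentation.
Variables (R : realType) (X : choiceType).
Local Notation C := (R[i]%C).
Local Notation Ch := (Ch R).

(* the [(hbar_1, hbar_2)]-adic completion of the free algebra on [X]; a series
   in [hbar_2] of series in [hbar_1], as in [Ch] *)
Definition freeser := fps (fps {malg C[{fmonom X}]}).
HB.instance Definition _ := GRing.NzRing.on freeser.

Definition freeser_csc : Ch -> freeser :=
  locked_with alg_key (fun s => fps_map (fps_map (@malgC {fmonom X} C)) s).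
Lemma freeser_cscE s : freeser_csc s = fps_map (fps_map (@malgC {fmonom X} C)) s.
Proof. by rewrite /freeser_csc locked_withE. Qed.
Fact freeser_csc_zmod : zmod_morphism freeser_csc.
Proof. by move=> s t; rewrite !freeser_cscE rmorphB. Qed.
Fact freeser_csc_monoid : monoid_morphism freeser_csc.
Proof. by split=> [|s t]; rewrite !freeser_cscE ?rmorph1 ?rmorphM. Qed.
Fact freeser_csc_central s a : freeser_csc s * a = a * freeser_csc s.
Proof.
rewrite freeser_cscE.
apply: fps_map_central => {s a} s a; apply: fps_map_central => {s a} c g.
exact: malgC_central.
Qed.
HB.instance Definition _ := PzRing_isCAlg.Build Ch freeser
  freeser_csc_zmod freeser_csc_monoid freeser_csc_central.

Definition fgen : X -> freeser :=
  locked_with alg_key (fun x => fcst (fcst << fmu x >>)).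
Lemma fgenE x : fgen x = fcst (fcst << fmu x >>).
Proof. by rewrite /fgen locked_withE. Qed.

(* the closure, for the [(hbar_1, hbar_2)]-adic topology, of the two-sided ideal
   generated by [rels] *)
Definition closed_ideal (rels : set freeser) : set freeser :=
  [set u | forall p, exists2 v, ideal_gen rels v &
    forall a b, (a + b < p)%N -> fco (fco u b) a = fco (fco v b) a].

Variable rels : set freeser.

Definition pres := quot (closed_ideal rels).

Definition pgen (x : X) : pres := qpi _ (fgen x).

End Presentation.

Definition brack (A : pzRingType) (a b : A) : A := a * b - b * a.
Definition qbrack (S : comPzRingType) (A : calgType S) (x : S) (a b : A) : A :=
  a * b - x *! (b * a).
Definition anti (A : pzRingType) (a b : A) : A := a * b + b * a.
Definition sym2 (I : Type) (A : zmodType) (F : I -> I -> A) (a b : I) : A :=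
  F a b + F b a.
Definition sym3 (I : Type) (A : zmodType) (F : I -> I -> I -> A) (a b c : I) : A :=
  F a b c + F a c b + F b a c + F b c a + F c a b + F c b a.

(** * Indices modulo [N] *)

(* [j = i + 1] modulo [N] *)
Definition next (N i j : nat) : bool := j == i.+1 %[mod N].

(* Cartan matrix, for [i, j < N] *)
Definition cartan (N i j : nat) : int :=
  if (N <= 1)%N then 0
  else if N == 2%N then (if i == j then 2 else -2)
  else if i == j then 2 else if next N i j || next N j i then -1 else 0.

Definition mskew (N i j : nat) : int :=
  if (2 < N)%N then (if next N j i then 1 else if next N i j then -1 else 0)
  else 0.

(** * The formal quantum toroidal algebra *)

Inductive Ugen (m : nat) :=
| Ue of 'I_m & int
| Uf of 'I_m & int
| Uh of 'I_m & int.
HB.instance Definition _ m := gen_eqMixin (Ugen m).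
HB.instance Definition _ m := gen_choiceMixin (Ugen m).

Section Toroidal.
Variables (R : realType) (m n : nat) (ko : int).
Local Notation C := (R[i]%C).
Local Notation Ch := (Ch R).
Local Notation omega := (omega R m n ko).
Local Notation a_ i j := (cartan m i j).
Local Notation m_ i j := (mskew m i j).

(* the integral powers [q_1^z], [q^z] and [d^z], where [d = q_1 q] *)
Definition q1pow (z : int) : Ch := cC (omega ^ z) * hexp (z%:~R / m%:R) 0.
Definition qpow (z : int) : Ch := hexp 0 (z%:~R / (2 * m)%:R).
Definition dpow (z : int) : Ch := q1pow z * qpow z.
Definition q1 : Ch := q1pow 1.
Definition q2 : Ch := hexp 0 m%:R^-1.
Definition q3 : Ch := cC omega^-1 * hexp (- m%:R^-1) (- m%:R^-1).
(* [q - q^-1] *)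
Definition qq : Ch := qpow 1 - qpow (-1).

Definition qint (z : int) : Ch := fquot (qpow z - qpow (- z)) qq.

Definition bU (i j : 'I_m) (k : int) : Ch :=
  if k == 0 then (a_ i j)%:~R
  else if (2 < m)%N then cC k%:~R^-1 * qint (k * a_ i j) * dpow (- k * m_ i j)
  else if m == 2%N then
    cC k%:~R^-1 * qint (2 * k) *+ (j == i)
    - cC k%:~R^-1 * qint k * (dpow k + dpow (- k)) *+ next m i j
  else cC k%:~R^-1 * qint k * (qpow k + qpow (- k) - dpow k - dpow (- k)).

Definition dU (i j : 'I_m) : Ch :=
  if (2 < m)%N then
    (if next m i j then dpow (-1) else if next m j i then dpow 1 else 1)
  else if (m == 2%N) && (j != i) then -1 else 1.

(* [g_{i,j}(z, w)] is the product of the [z - c w] for [c] in this list *)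
Definition groots (i j : 'I_m) : seq Ch :=
  if (2 < m)%N then [:: qpow (a_ i j) * dpow (- m_ i j)]
  else if m == 2%N then (if i == j then [:: q2] else [:: q1; q3])
  else [:: q1; q2; q3].

Local Notation free := (freeser R (Ugen m)).

(* For [F(z, w) = \sum_(k, l) (F k l) z^-k w^-l], the coefficient of [z^-k w^-l]
   in [g_{i,j}(z, w) F(z, w)] *)
Definition gU (i j : 'I_m) (F : int -> int -> free) (k l : int) : free :=
  let P := \prod_(c <- groots i j) ('X - c%:P) in
  \sum_(t < (size (groots i j)).+1)
     P`_t *! F (k + t%:Z) (l + (size (groots i j) - t)%:Z).

Local Notation gen x := (@fgen R (Ugen m) x).
Definition ef (b : bool) (i : 'I_m) (k : int) : free :=
  if b then gen (Ue i k) else gen (Uf i k).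
Local Notation e := (ef true).
Local Notation f := (ef false).
Local Notation h i k := (gen (Uh i k)).

(* [psi_i^s(z)], for a sign [s], as a series in [z^-s] *)
Definition psi (s : int) (i : 'I_m) : fps free :=
  fcst (fcomp (fun j => fcst (exp_co j)%:MP)
              ((cC (s%:~R / (2 * m)%:R) * hbar2) *! h i 0))
  * fcomp (fun j => csc (cC (exp_co j)))
          (FPS (fun r : nat => if r == 0%N then 0
                               else (s%:~R * qq) *! h i (s * r%:Z))).

(* coefficients of [z^-r] in [psi_i^+(z)] and in [psi_i^-(z)] *)
Definition psip (i : 'I_m) (r : int) : free :=
  if 0 <= r then fco (psi 1 i) `|r|%N else 0.
Definition psim (i : 'I_m) (r : int) : free :=
  if r <= 0 then fco (psi (-1) i) `|r|%N else 0.

(* Each relation is the coefficient of a monomial in [z], [w], ..., written as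
   an element that is set to zero. In [Urel_ef], [x] is the quotient by [q - q^-1]
   in the completed free algebra, which has no torsion. *)
Inductive Urel : set free :=
| Urel_hh (i j : 'I_m) (k l : int) : Urel (brack (h i k) (h j l))
| Urel_ef (i : 'I_m) (k l : int) x :
    qq *! x = psip i (k + l) - psim i (k + l) ->
    Urel (brack (e i k) (f i l) - x)
| Urel_ef0 (i j : 'I_m) (k l : int) : i != j -> Urel (brack (e i k) (f j l))
| Urel_ee (i j : 'I_m) (k l : int) :
    Urel (dU i j *! gU i j (fun a b => e i a * e j b) k l
          + gU j i (fun b a => e j b * e i a) l k)
| Urel_ff (i j : 'I_m) (k l : int) :
    Urel (dU j i *! gU j i (fun b a => f i a * f j b) l k
          + gU i j (fun a b => f j b * f i a) k l)
| Urel_he (i j : 'I_m) (k l : int) :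
    Urel (brack (h i k) (e j l) - bU i j k *! e j (l + k))
| Urel_hf (i j : 'I_m) (k l : int) :
    Urel (brack (h i k) (f j l) + bU i j k *! f j (l + k))
| Urel_serre0 (b : bool) (i j : 'I_m) (k l : int) : (2 < m)%N -> a_ i j = 0 ->
    Urel (brack (ef b i k) (ef b j l))
| Urel_serre2 (b : bool) (i j : 'I_m) (k1 k2 l : int) :
    (2 < m)%N -> next m i j || next m j i ->
    Urel (sym2 (fun k1 k2 =>
      qbrack (qpow (-1)) (ef b i k1) (qbrack (qpow 1) (ef b i k2) (ef b j l))) k1 k2)
| Urel_serre3 (b : bool) (i j : 'I_m) (k1 k2 k3 l : int) : m = 2%N -> next m i j ->
    Urel (sym3 (fun k1 k2 k3 =>
      qbrack (qpow (-2)) (ef b i k1)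
        (brack (ef b i k2) (qbrack (qpow 2) (ef b i k3) (ef b j l)))) k1 k2 k3)
| Urel_serre1 (b : bool) (i : 'I_m) (k1 k2 k3 : int) : m = 1%N ->
    Urel (sym3 (fun k1 k2 k3 =>
      brack (ef b i k1) (brack (ef b i (k2 + 1)) (ef b i (k3 - 1)))) k1 k2 k3).

Definition toroidal := pres Urel.

Definition toroidal_gen (x : Ugen m) : toroidal := pgen Urel x.

(* [U / (hbar_2)] *)
Definition toroidal0 := quot [set csc hbar2 : toroidal].

Definition toroidal0_gen (x : Ugen m) : toroidal0 := qpi _ (toroidal_gen x).

End Toroidal.

(** * The formal affine Yangian *)

(* [Yx true i r] is [x^+_{i,r}] and [Yx false i r] is [x^-_{i,r}] *)
Inductive Ygen (N : nat) :=
| Yx of bool & 'I_N & nat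
| Yxi of 'I_N & nat.
HB.instance Definition _ N := gen_eqMixin (Ygen N).
HB.instance Definition _ N := gen_choiceMixin (Ygen N).

Definition Ydeg (N : nat) (y : Ygen N) : nat :=
  match y with Yx _ _ r => r | Yxi _ r => r end.

(* For a family [g] of elements with degrees [deg], the elements of degree at
   least [p] form the ideal generated by these monomials *)
Definition deg_ge (R : realType) (A : calgType (Ch R)) (G : Type) (g : G -> A)
    (deg : G -> nat) (p : nat) : set A :=
  [set x | exists a b (w : seq G),
     (p <= a + b + \sum_(y <- w) deg y)%N /\
     x = (hbar1 ^+ a * hbar2 ^+ b) *! \prod_(y <- w) g y].

Section Yangian.
Variables (R : realType) (N : nat).
Local Notation Ch := (Ch R).
Local Notation free := (freeser R (Ygen N)).
Local Notation a_ i j := (cartan N i j).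
Local Notation m_ i j := (mskew N i j).

Definition overN (s : Ch) : Ch := cC N%:R^-1 * s.
Local Notation h1 := (overN hbar1).
Local Notation h2 := (overN hbar2).
Local Notation h3 := (overN hbar3).
Definition Ybeta : Ch := cC 2^-1 * (h1 - h3).
Definition Ysigma2 : Ch := h1 * h2 + h1 * h3 + h2 * h3.
Definition Ysigma3 : Ch := h1 * h2 * h3.

Local Notation gen x := (@fgen R (Ygen N) x).
Local Notation x b i r := (gen (Yx b i r)).
Local Notation xi i r := (gen (Yxi i r)).
Definition Ysg (b : bool) : Ch := if b then 1 else -1.
(* the letter [y] of the relations: [x^b], or [xi] *)
Definition Yy (o b : bool) (i : 'I_N) (r : nat) : free :=
  if o then x b i r else xi i r.
Local Notation y := Yy.

Inductive Yrel : set free :=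
| Yrel_xixi (i j : 'I_N) (r s : nat) : Yrel (brack (xi i r) (xi j s))
| Yrel_xx (i j : 'I_N) (r s : nat) :
    Yrel (brack (x true i r) (x false j s) - (if i == j then xi i (r + s) else 0))
| Yrel_3quad (o b : bool) (i j : 'I_N) (r s : nat) : (2 < N)%N ->
    Yrel (brack (y o b i r.+1) (x b j s) - brack (y o b i r) (x b j s.+1)
          - (- ((m_ i j)%:~R * Ybeta) *! brack (y o b i r) (x b j s)
             + (Ysg b * (a_ i j)%:~R * (cC 2^-1 * h2))
                 *! anti (y o b i r) (x b j s)))
| Yrel_3xi0 (b : bool) (i j : 'I_N) (s : nat) : (2 < N)%N ->
    Yrel (brack (xi i 0) (x b j s) - (Ysg b * (a_ i j)%:~R) *! x b j s)
| Yrel_3serre (b : bool) (i j : 'I_N) (r1 r2 s : nat) :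
    (2 < N)%N -> next N i j || next N j i ->
    Yrel (sym2 (fun r1 r2 => brack (x b i r1) (brack (x b i r2) (x b j s))) r1 r2)
| Yrel_3comm (b : bool) (i j : 'I_N) (r s : nat) : (2 < N)%N -> a_ i j = 0 ->
    Yrel (brack (x b i r) (x b j s))
| Yrel_2quad (o b : bool) (i : 'I_N) (r s : nat) : N = 2%N ->
    Yrel (brack (y o b i r.+1) (x b i s) - brack (y o b i r) (x b i s.+1)
          - (Ysg b * h2) *! anti (y o b i r) (x b i s))
| Yrel_2cub (o b : bool) (i j : 'I_N) (r s : nat) : N = 2%N -> j != i ->
    Yrel (brack (y o b i r.+2) (x b j s) - 2 * brack (y o b i r.+1) (x b j s.+1)
          + brack (y o b i r) (x b j s.+2)
          - (- (h1 * h3) *! brack (y o b i r) (x b j s)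
             - (Ysg b * h2)
                 *! (anti (y o b i r.+1) (x b j s) - anti (y o b i r) (x b j s.+1))))
| Yrel_2xi0 (b : bool) (i j : 'I_N) (s : nat) : N = 2%N ->
    Yrel (brack (xi i 0) (x b j s) - (Ysg b * (a_ i j)%:~R) *! x b j s)
| Yrel_2xi1 (b : bool) (i j : 'I_N) (s : nat) : N = 2%N -> next N i j ->
    Yrel (brack (xi i 1) (x b j s)
          + Ysg b *! (2 * x b j s.+1 + h2 *! anti (xi i 0) (x b j s)))
| Yrel_2serre (b : bool) (i j : 'I_N) (r1 r2 r3 s : nat) : N = 2%N -> next N i j ->
    Yrel (sym3 (fun r1 r2 r3 =>
      brack (x b i r1) (brack (x b i r2) (brack (x b i r3) (x b j s)))) r1 r2 r3)
| Yrel_1quart (o b : bool) (i : 'I_N) (r s : nat) : N = 1%N ->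
    Yrel (brack (y o b i r.+3) (x b i s) - 3 * brack (y o b i r.+2) (x b i s.+1)
          + 3 * brack (y o b i r.+1) (x b i s.+2) - brack (y o b i r) (x b i s.+3)
          - (- Ysigma2 *! (brack (y o b i r.+1) (x b i s)
                           - brack (y o b i r) (x b i s.+1))
             + (Ysg b * Ysigma3) *! anti (y o b i r) (x b i s)))
| Yrel_1xi0 (b : bool) (i : 'I_N) (s : nat) : N = 1%N -> Yrel (brack (xi i 0) (x b i s))
| Yrel_1xi1 (b : bool) (i : 'I_N) (s : nat) : N = 1%N -> Yrel (brack (xi i 1) (x b i s))
| Yrel_1xi2 (b : bool) (i : 'I_N) (s : nat) : N = 1%N ->
    Yrel (brack (xi i 2) (x b i s) - (Ysg b * (2 * h1 * h3)) *! x b i s)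
| Yrel_1serre (b : bool) (i : 'I_N) (r1 r2 r3 : nat) : N = 1%N ->
    Yrel (sym3 (fun r1 r2 r3 =>
      brack (x b i r1) (brack (x b i r2) (x b i r3.+1))) r1 r2 r3).

Definition yangian := pres Yrel.

Definition yangian_gen (z : Ygen N) : yangian := pgen Yrel z.

Definition yangian0 := quot [set csc hbar2 : yangian].

Definition yangian0_gen (z : Ygen N) : yangian0 := qpi _ (yangian_gen z).

Definition yangian_hat := compl (deg_ge yangian_gen (@Ydeg N)).

Definition yangian_hat0 := quot [set csc hbar2 : yangian_hat].

End Yangian.

(** * Central extensions of matrix algebras and their enveloping algebras *)

Section CentralExtension.
Variables (R : realType) (A : calgType (Ch R)) (N : nat).
Local Notation C := (R[i]%C).
Local Notation Ch := (Ch R).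
Local Notation Ch1 := (Ch1 R).
Local Notation cocycle := ('M[A]_N -> 'M[A]_N -> Ch1).

(* the matrix unit [E_{a,b}], with [1 <= a, b <= N], tensored with [u] *)
Definition Emx (a b : nat) (u : A) : 'M[A]_N :=
  \matrix_(i, j) if (i.+1 == a) && (j.+1 == b) then u else 0.

(* [M] tensored with [u] *)
Definition mtens (M : 'M[C]_N) (u : A) : 'M[A]_N :=
  map_mx (fun c => cC c *! u) M.

Definition bilinear_form (phi : cocycle) : Prop :=
  [/\ forall x x' y, phi (x + x') y = phi x y + phi x' y,
      forall x y y', phi x (y + y') = phi x y + phi x y',
      forall (s : Ch) x y, phi (csc s *: x) y = red2 s * phi x y
    & forall (s : Ch) x y, phi x (csc s *: y) = red2 s * phi x y].

(* pairs of a matrix and of the coefficient of the central element *)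
Definition cext := ('M[A]_N * Ch1)%type.
HB.instance Definition _ := Choice.on cext.
HB.instance Definition _ := GRing.Zmodule.on cext.

Definition cext_scale (s : Ch) (x : cext) : cext := (csc s *: x.1, red2 s * x.2).
Definition cext_br (phi : cocycle) (x y : cext) : cext :=
  (brack x.1 y.1, phi x.1 y.1).
Definition cmat (M : 'M[A]_N) : cext := (M, 0).
Definition ccentral : cext := (0, 1).

Variable phi : cocycle.
Local Notation gen x := (@fgen R cext x).

Inductive env_rel : set (freeser R cext) :=
| env_add (x y : cext) : env_rel (gen (x + y) - gen x - gen y)
| env_scale s (x : cext) : env_rel (gen (cext_scale s x) - s *! gen x)
| env_br (x y : cext) : env_rel (brack (gen x) (gen y) - gen (cext_br phi x y))
| env_hbar2 : env_rel (csc hbar2).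

(* the [hbar_1]-adically complete universal enveloping algebra over
   [C[[hbar_1]]] of the central extension of ['M[A]_N] by [phi] *)
Definition env := pres env_rel.
Definition env_in (x : cext) : env := pgen env_rel x.

End CentralExtension.

(* the continuous extension of a bilinear form to matrices over a completion *)
Definition ext_form (R : realType) (A : calgType (Ch R)) (J : nat -> set A)
    (N : nat) (phi : 'M[A]_N -> 'M[A]_N -> Ch1 R)
    (X Y : 'M[compl J]_N) : Ch1 R :=
  xget 0 [set s | forall p, exists r, forall X' Y' : 'M[A]_N,
    (forall i j, cproj (X i j) r = qpi (J r) (X' i j)) ->
    (forall i j, cproj (Y i j) r = qpi (J r) (Y' i j)) ->
    forall a, (a < p)%N -> fco (phi X' Y') a = fco s a].

Definition is_lie_hom (R : realType) (A B : calgType (Ch R)) (M N : nat)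
    (phi : 'M[A]_M -> 'M[A]_M -> Ch1 R) (psi : 'M[B]_N -> 'M[B]_N -> Ch1 R)
    (F : cext A M -> cext B N) : Prop :=
  [/\ forall x y, F (x + y) = F x + F y,
      forall s x, F (cext_scale s x) = cext_scale s (F x)
    & forall x y, F (cext_br phi x y) = cext_br psi (F x) (F y)].

(* [u ^ z] for a unit [u] with inverse [v] *)
Definition zpow (A : pzRingType) (u v : A) (z : int) : A :=
  match z with Posz a => u ^+ a | Negz a => v ^+ a.+1 end.

(** ** Difference operators *)

Inductive dgen := gZ | gZi | gD | gDi.
HB.instance Definition _ := gen_eqMixin dgen.
HB.instance Definition _ := gen_choiceMixin dgen.

Section Difference.
Variables (R : realType) (m n : nat) (ko : int).
Local Notation C := (R[i]%C).
Local Notation Ch := (Ch R).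
Local Notation Ch1 := (Ch1 R).
Local Notation gen x := (@fgen R dgen x).

(* [Q^z] for [Q = omega_n exp(hbar_1)] *)
Definition Qpow (z : int) : Ch := cC (omega_n R m n ko ^ z) * hexp z%:~R 0.
Definition Q : Ch := Qpow 1.

Inductive diffop_rel : set (freeser R dgen) :=
| diff_ZZi : diffop_rel (gen gZ * gen gZi - 1)
| diff_ZiZ : diffop_rel (gen gZi * gen gZ - 1)
| diff_DDi : diffop_rel (gen gD * gen gDi - 1)
| diff_DiD : diffop_rel (gen gDi * gen gD - 1)
| diff_DZ : diffop_rel (gen gD * gen gZ - Q *! (gen gZ * gen gD))
| diff_hbar2 : diffop_rel (csc hbar2).

Definition diffop := pres diffop_rel.
Definition Zpow (z : int) : diffop := zpow (pgen diffop_rel gZ) (pgen diffop_rel gZi) z.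
Definition Dpow (z : int) : diffop := zpow (pgen diffop_rel gD) (pgen diffop_rel gDi) z.

(* the value at [x = Q^s] of the Laurent polynomial [(1 - x^l) / (1 - x)] *)
Definition Qgeo (l s : int) : Ch :=
  match l with
  | Posz a => \sum_(j < a) Qpow (j%:Z * s)
  | Negz a => - \sum_(j < a.+1) Qpow (- (j.+1)%:Z * s)
  end.

Definition is_diffop_cocycle (phi : 'M[diffop]_m -> 'M[diffop]_m -> Ch1) : Prop :=
  bilinear_form phi /\
  forall (M1 M2 : 'M[C]_m) (k1 k2 l1 l2 : int),
    phi (mtens M1 (Dpow k1 * Zpow l1)) (mtens M2 (Dpow k2 * Zpow (- l2))) =
    if l1 == l2 then
      red2 (cC (\tr (M1 *m M2)) * Qpow (- l1 * k2) * Qgeo l1 (k1 + k2))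
    else 0.

(* the ideal [(D^n - 1, hbar_1)] *)
Definition diffop_J : set diffop := [set u | u = Dpow n%:Z - 1 \/ u = csc hbar1].
Definition diffop_hat := compl (ideal_pow diffop_J).

Variable phi : 'M[diffop]_m -> 'M[diffop]_m -> Ch1.

Local Notation Ud := (env phi).
Local Notation cE a b u := (cmat (@Emx R diffop m a b u)).
Local Notation cc := (ccentral diffop m).

(* [(q_1^z D)^k] *)
Definition qDpow (z k : int) : diffop := q1pow R m n ko (z * k) *! Dpow k.

Definition theta_val (x : Ugen m) : cext diffop m :=
  match x with
  | Ue i k => if i == 0%N :> nat then cE m 1 (Dpow k * Zpow 1)
              else cE i i.+1 (qDpow (m%:Z - i%:Z) k)
  | Uf i k => if i == 0%N :> nat then cE 1 m (Zpow (-1) * Dpow k)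
              else cE i.+1 i (qDpow (m%:Z - i%:Z) k)
  | Uh i k => if i == 0%N :> nat
              then cE m m (Dpow k) - cE 1 1 (qDpow m%:Z k) + cc
              else cE i i (qDpow (m%:Z - i%:Z) k)
                   - cE i.+1 i.+1 (qDpow (m%:Z - i%:Z) k)
  end.

Definition is_theta (theta : {rmorphism toroidal0 R m n ko -> Ud}) : Prop :=
  is_alghom theta /\
  forall x, theta (toroidal0_gen R n ko x) = env_in phi (theta_val x).

(* The enveloping algebra of the quotient of the central extension by
   [Mat_m (D^n - 1, hbar_1)], over [C = C[[hbar_1]]/(hbar_1)]: the quotient of
   [Ud] by the ideal generated by this Lie ideal and by [hbar_1] *)
Definition env_red_J : set Ud :=
  [set u | (exists2 M : 'M[diffop]_m, forall i j, ideal_gen diffop_J (M i j)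
                                  & u = env_in phi (cmat M))
           \/ u = csc hbar1].
Definition env_red := quot env_red_J.

Definition toroidal_J (theta : toroidal0 R m n ko -> Ud) : set (toroidal R m n ko) :=
  [set u | qpi env_red_J (theta (qpi _ u)) = 0].

Definition toroidal_hat (theta : toroidal0 R m n ko -> Ud) :=
  compl (ideal_pow (toroidal_J theta)).

Definition toroidal_hat0 (theta : toroidal0 R m n ko -> Ud) :=
  quot [set csc hbar2 : toroidal_hat theta].

End Difference.

(** ** Differential operators *)

Inductive Dgen := gpartial | gx | gxi.
HB.instance Definition _ := gen_eqMixin Dgen.
HB.instance Definition _ := gen_choiceMixin Dgen.

Section Differential.
Variables (R : realType) (N : nat).
Local Notation C := (R[i]%C).
Local Notation Ch := (Ch R).
Local Notation Ch1 := (Ch1 R).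
Local Notation gen x := (@fgen R Dgen x).

Inductive dop_rel : set (freeser R Dgen) :=
| dop_xxi : dop_rel (gen gx * gen gxi - 1)
| dop_xix : dop_rel (gen gxi * gen gx - 1)
| dop_px : dop_rel (gen gpartial * gen gx - gen gx * (gen gpartial + csc hbar1))
| dop_hbar2 : dop_rel (csc hbar2).

Definition dop := pres dop_rel.
Definition partial : dop := pgen dop_rel gpartial.
Definition xpow (z : int) : dop := zpow (pgen dop_rel gx) (pgen dop_rel gxi) z.

(* [f(partial)] *)
Definition dop_poly (f : {poly Ch1}) : dop :=
  \sum_(t < size f) fcst f`_t *! partial ^+ t.

(* [z hbar_1] *)
Definition h1z (z : int) : Ch1 := z%:~R * fX.

Definition is_dop_cocycle (phi : 'M[dop]_N -> 'M[dop]_N -> Ch1) : Prop :=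
  bilinear_form phi /\
  forall (M1 M2 : 'M[C]_N) (f1 f2 : {poly Ch1}) (k l : int),
    phi (mtens M1 (dop_poly f1 * xpow k)) (mtens M2 (dop_poly f2 * xpow l)) =
    if k != - l then 0 else
    match k with
    | Posz k' => fcst (\tr (M1 *m M2))
                 * \sum_(a < k') f1.[h1z a%:Z] * f2.[h1z (a%:Z - k)]
    | Negz k' => - fcst (\tr (M1 *m M2))
                 * \sum_(a < k'.+1) f2.[h1z a%:Z] * f1.[h1z (a%:Z + k)]
    end.

(* the ideal [(partial, hbar_1)] *)
Definition dop_J : set dop := [set u | u = partial \/ u = csc hbar1].
Definition dop_hat := compl (ideal_pow dop_J).

(* [exp (c partial)] *)
Definition exp_partial (c : C) : dop_hat :=
  csum (fun r => cC (c ^+ r / (r`!)%:R) *! cin _ (partial ^+ r)).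

Variable phi : 'M[dop]_N -> 'M[dop]_N -> Ch1.

Local Notation UD := (env phi).
Local Notation cE a b u := (cmat (@Emx R dop N a b u)).
Local Notation cc := (ccentral dop N).

(* [(partial + (1 - i/N) hbar_1)^r] *)
Definition dshift (i r : nat) : dop :=
  (partial + csc (cC (1 - i%:R / N%:R) * hbar1)) ^+ r.

Definition vartheta_val (y : Ygen N) : cext dop N :=
  match y with
  | Yx true i r => if i == 0%N :> nat then cE N 1 (partial ^+ r * xpow 1)
                   else cE i i.+1 (dshift i r)
  | Yx false i r => if i == 0%N :> nat then cE 1 N (xpow (-1) * partial ^+ r)
                    else cE i.+1 i (dshift i r)
  | Yxi i r => if i == 0%N :> nat
               then cE N N (partial ^+ r) - cE 1 1 ((partial + csc hbar1) ^+ r)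
                    + cc *+ (r == 0%N)
               else cE i i (dshift i r) - cE i.+1 i.+1 (dshift i r)
  end.

Definition is_vartheta (vartheta : {rmorphism yangian0 R N -> UD}) : Prop :=
  is_alghom vartheta /\
  forall y, vartheta (yangian0_gen R y) = env_in phi (vartheta_val y).

(* generators of [UD]: [E_{a,b} partial^r x^k], of degree [r], and the central
   element, of degree [0] *)
Inductive UDgen := UDe of 'I_N & 'I_N & nat & int | UDc.
Definition UDgen_val (z : UDgen) : UD :=
  match z with
  | UDe a b r k => env_in phi (cE a.+1 b.+1 (partial ^+ r * xpow k))
  | UDc => env_in phi cc
  end.
Definition UDdeg (z : UDgen) : nat := if z is UDe _ _ r _ then r else 0%N.

Definition UD_hat := compl (deg_ge UDgen_val UDdeg).

(* the extension of [vartheta] to the completions: modulo degree [p],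
   it is given by the value of [vartheta] on any approximation modulo degree [p] *)
Definition is_vartheta_hat (vartheta : yangian0 R N -> UD)
    (vhat : {rmorphism yangian_hat0 R N -> UD_hat}) : Prop :=
  is_alghom vhat /\
  forall (y : yangian_hat R N) (p : nat) (u : yangian R N),
    cproj y p = qpi _ u ->
    cproj (vhat (qpi _ y)) p = qpi _ (vartheta (qpi _ u)).

(* [z] is the image of [y] under the map from the completed Lie algebra
   to the completed enveloping algebra *)
Definition is_env_hat_in (y : cext dop_hat N) (z : UD_hat) : Prop :=
  forall (p : nat) (M : 'M[dop]_N),
    (forall i j, cproj (y.1 i j) p = qpi _ (M i j)) ->
    cproj z p = qpi _ (env_in phi (M, y.2)).

End Differential.

(** * The homomorphism from difference to differential operators *)

Section Upsilon.
Variables (R : realType) (m n : nat) (ko : int).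
Local Notation diffop := (diffop R m n ko).
Local Notation dop := (dop R).
Local Notation dhat := (diffop_hat R m n ko).
Local Notation Dhat := (dop_hat R).
Local Notation Q := (Q R m n ko).
Variables (phid : 'M[diffop]_m -> 'M[diffop]_m -> Ch1 R).
Variables (phiD : 'M[dop]_(m * n) -> 'M[dop]_(m * n) -> Ch1 R).

Definition Upsilon_D : 'M[Dhat]_n :=
  \sum_(1 <= a < n.+1) Emx n a a ((Q ^+ (n - a)) *! exp_partial n%:R).
Definition Upsilon_Z : 'M[Dhat]_n :=
  \sum_(1 <= a < n) Emx n a a.+1 1 + Emx n n 1 (cin _ (xpow R 1)).

(* [\sum_(a, b) E_{a,b} (X a b)] in [Mat_m (Mat_n)], seen in [Mat_{mn}] through
   [E_{a,b} E_{k,l} |-> E_{m(k-1)+a, m(l-1)+b}], with indices starting at [1] *)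
Definition mflat (X : 'M['M[Dhat]_n]_m) : 'M[Dhat]_(m * n) :=
  \sum_(a < m) \sum_(b < m) \sum_(k < n) \sum_(l < n)
    Emx (m * n) (m * k + a.+1) (m * l + b.+1) (X a b k l).

Definition is_Upsilon (Ups : cext dhat m -> cext Dhat (m * n)) : Prop :=
  [/\ is_lie_hom (ext_form phid) (ext_form phiD) Ups,
      Ups (ccentral _ _) = ccentral _ _
    & exists ups : {rmorphism diffop -> 'M[Dhat]_n},
      [/\ forall s, ups (csc s) = (csc s)%:M,
          ups (Dpow R m n ko 1) = Upsilon_D, ups (Zpow R m n ko 1) = Upsilon_Z
        & forall M : 'M[diffop]_m,
            Ups (cmat (map_mx (@cin _ _) M)) = cmat (mflat (map_mx ups M))]].

(* [UUps] is the homomorphism of enveloping algebras induced by [Ups] *)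
Definition is_U_Upsilon (Ups : cext dhat m -> cext Dhat (m * n))
    (UUps : {rmorphism env phid -> UD_hat phiD}) : Prop :=
  is_alghom UUps /\
  forall (M : 'M[diffop]_m) (s : Ch1 R),
    is_env_hat_in (Ups (map_mx (@cin _ _) M, s)) (UUps (env_in phid (M, s))).

End Upsilon.

(** * The homomorphism from the quantum toroidal algebra to the Yangian *)

Section Phi.
Variables (R : realType) (m n : nat) (ko : int).
Local Notation C := (R[i]%C).
Local Notation N := (m * n)%N.
Local Notation omega := (omega R m n ko).
Local Notation free := (freeser R (Ygen N)).
Local Notation Yhat := (yangian_hat R N).
Local Notation qq := (qq R m).

Definition to_Yhat (u : free) : Yhat := cin _ (qpi _ u).
Definition Yhat_gen (y : Ygen N) : Yhat := cin _ (yangian_gen R y).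

(* [log xi_i(z)] as a series in [z^-1], and its coefficients [t_{i,r}] *)
Definition logxi (i : 'I_N) : fps free :=
  fcomp (fun j => csc (cC (log1p_co j)))
    (FPS (fun r : nat => if r is r'.+1
      then (cC N%:R^-1 * hbar2) *! fgen R (Yxi i r') else 0)).
Definition tfree (i : 'I_N) (r : nat) : free := fco (logxi i) r.+1.
Definition tY (i : 'I_N) (r : nat) : Yhat := to_Yhat (tfree i r).

(* [B_i(w) / (q - q^-1)]; the division takes place in the completed free algebra,
   which has no torsion *)
Definition Bqq (i : 'I_N) (w : C) : Yhat :=
  csum (fun r => cC (w ^+ r / (r`!)%:R)
                 *! to_Yhat (fquot (tfree i r) (csc qq))).

(* series in [v] *)
Definition expv (c : C) : fps C := FPS (fun r => c ^+ r / (r`!)%:R).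

Definition HY (i j : 'I_N) : fps C :=
  if i == j then
    fquot (fcst n%:R * fX) (expv (n%:R / 2) - expv (- n%:R / 2))
  else
    fquot (fcst (omega ^ (- i%:Z) - omega ^ (- j%:Z)))
      (fcst (omega ^ (- i%:Z)) * expv (n%:R / 2)
       - fcst (omega ^ (- j%:Z)) * expv (- n%:R / 2)).
Definition GY (i j : 'I_N) : fps C := fcomp log1p_co (HY i j - 1).

(* [- B_j(- d/dv) (d/dv) G_{i,j}(v)] *)
Definition gammaY (i j : 'I_N) : fps Yhat :=
  FPS (fun p => - csum (fun r =>
    cC ((-1) ^+ r / (r`!)%:R * fco (iter r.+1 (@fderiv C) (GY i j)) p)
    *! tY j r)).

(* [(hbar_2 / (m (q - q^-1)))^(1/2)] *)
Definition sqrt_factor : Ch R :=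
  fcomp (fun j => fcst (sqrt1p_co j)) (fquot hbar2 (cC m%:R * qq) - 1).

Definition half_gamma (i : 'I_N) : fps Yhat :=
  fcst (csc (cC 2^-1)) * \sum_(j < N | j == i %[mod m]) gammaY i j.
(* the exponential converges for the grading, as [gammaY] has positive degree *)
Definition gY (i : 'I_N) : fps Yhat :=
  FPS (fun p => sqrt_factor *!
    csum (fun j => cC (exp_co j) *! fco (half_gamma i ^+ j) p)).
(* [g^{(k)}_{i,r}] *)
Definition gkY (k : int) (i : 'I_N) (r : nat) : Yhat :=
  fco (FPS (fun s : nat => csc (cC ((k%:~R * n%:R) ^+ s / (s`!)%:R))) * gY i) r.

Definition Phi_x (b : bool) (i : 'I_m) (k : int) : Yhat :=
  \sum_(i' < N | i' == i %[mod m])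
    cC (omega ^ (- (k * i'%:Z)))
    *! csum (fun r => gkY k i' r * Yhat_gen (Yx b i' r)).

Definition Phi_val (x : Ugen m) : Yhat :=
  match x with
  | Ue i k => Phi_x true i k
  | Uf i k => Phi_x false i k
  | Uh i l => if l == 0 then \sum_(i' < N | i' == i %[mod m]) Yhat_gen (Yxi i' 0)
              else \sum_(i' < N | i' == i %[mod m])
                     cC (n%:R * omega ^ (- (l * i'%:Z))) *! Bqq i' (l%:~R * n%:R)
  end.

Variable phid : 'M[diffop R m n ko]_m -> 'M[diffop R m n ko]_m -> Ch1 R.
Variable theta : toroidal0 R m n ko -> env phid.

Definition is_Phi (Phi : {rmorphism toroidal_hat theta -> Yhat}) : Prop :=
  is_alghom Phi /\
  forall x, Phi (cin _ (toroidal_gen R n ko x)) = Phi_val x.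

(* the reduction of [Phi] modulo [hbar_2], and its composition with
   [U/(hbar_2) -> U^/(hbar_2)] *)
Definition Phi_bar (Phi : toroidal_hat theta -> Yhat) :
  toroidal_hat0 theta -> yangian_hat0 R N := qmap Phi.
Definition toroidal0_hat : toroidal0 R m n ko -> toroidal_hat0 theta :=
  qmap (@cin _ _).

End Phi.

(* Main.v *)
(* Both sides are ring homomorphisms on a presented algebra with values in a
   completion in which [hbar_2 = 0] and [hbar_1^p] vanishes in degree below [p]; this
   forces continuity, so it is enough to compare them on the generators, modulo
   each degree [p]. Modulo [hbar_2] the series [g_{i'}] is [1], because each
   [t_{i',r}] is divisible by [hbar_2], and [B_{i'}(l n) / (q - q^-1)] becomes
   [(1/n) sum_r (l n)^r / r! xi_{i',r}]. Hence a generator of mode [k] goes to a sum of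
   [omega^(- k i') exp (k n (partial + (1 - i' / mn) hbar_1))] tensored with matrix
   units over the [i'] congruent to [i]. On the other side the image of [D^k] is
   diagonal with entries [Q^(k (n - a)) exp (k n partial)]. Writing [i' = m (a - 1) + i],
   the powers of [omega] and of [exp hbar_1] agree because [omega^(mn) = 1]. *)

Require Import Defs.
From HB Require Import structures.
From mathcomp Require Import all_boot all_order all_algebra.
From mathcomp Require Import complex boolp classical_sets reals trigo finmap monalg.
From mathcomp Require Import zify ring.
Import GRing.Theory Num.Theory.
Local Open Scope ring_scope.

Set Implicit Arguments.
Unset Strict Implicit.
Unset Printing Implicit Defensive.

(** * Ideals, completions and power series *)

(** Infinite sums are handled only at a fixed level [p]. Since [csum] is a choice operator, each use
    needs a proof of convergence; [summable] asks that term [r] vanish at level [p] as soon as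
    [r >= p], and then every sum becomes one over [r < p.+1]. Both sides yield the same truncated
    Lie algebra element [ztrunc p x]. The Yangian side divides by [q - q^-1], which is a multiple of
    [hbar_2], so one cannot reduce modulo [hbar_2] first. The quotient [t_{i,r} / hbar_2] is
    therefore written out in the completed free algebra, where [hbar_2] can be cancelled. Vertex 0
    is exceptional in both [theta] and [vartheta], and passing from [I] to [I + 1] may carry from
    one block to the next. Where the successor of an index occurs, it is represented in [[1, mn]]
    instead of [[0, mn)]: vertex 0 then obeys the general shift [1 - s / mn] with [s = mn], and only
    the powers of [x] and the central term remain exceptional. *)

Section IdealTheory.
Variable A : pzRingType.
Implicit Types (J : set A) (x y a : A).

Lemma ideal_gen0 J : ideal_gen J 0.
Proof. by case: (ideal_gen_ideal J). Qed.

Lemma ideal_genB J x y : ideal_gen J x -> ideal_gen J y -> ideal_gen J (x - y).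
Proof. by case: (ideal_gen_ideal J) => _ h _ _; apply: h. Qed.

Lemma ideal_genD J x y : ideal_gen J x -> ideal_gen J y -> ideal_gen J (x + y).
Proof.
move=> hx hy; rewrite -[y]opprK; apply: ideal_genB => //.
by rewrite -sub0r; apply: ideal_genB => //; exact: ideal_gen0.
Qed.

Lemma ideal_genMl J a x : ideal_gen J x -> ideal_gen J (a * x).
Proof. by case: (ideal_gen_ideal J) => _ _ h _; apply: h. Qed.

Lemma ideal_genMr J a x : ideal_gen J x -> ideal_gen J (x * a).
Proof. by case: (ideal_gen_ideal J) => _ _ _ h; apply: h. Qed.

Lemma ideal_gen_sum J (I : Type) (s : seq I) (P : pred I) (F : I -> A) :
  (forall i, P i -> ideal_gen J (F i)) -> ideal_gen J (\sum_(i <- s | P i) F i).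
Proof.
move=> h; elim/big_rec: _ => [|i x Pi hx]; first exact: ideal_gen0.
by apply: ideal_genD; first exact: h.
Qed.

Lemma qpi_eq0 J x : qpi J x = 0 <-> ideal_gen J x.
Proof.
have -> : (0 : quot J) = qpi J 0 by rewrite rmorph0.
by rewrite (qpiP J) subr0.
Qed.

End IdealTheory.

Lemma rmorph_ideal_gen (A B : pzRingType) (J : set A) (K : set B)
    (f : {rmorphism A -> B}) :
  (forall x, J x -> ideal_gen K (f x)) ->
  forall x, ideal_gen J x -> ideal_gen K (f x).
Proof.
move=> fJ x /(_ [set y | ideal_gen K (f y)]%classic); apply=> //.
split=> [|u v|a u|a u] /=.
- by rewrite rmorph0; exact: ideal_gen0.
- by rewrite rmorphB; exact: ideal_genB.
- by rewrite rmorphM; exact: ideal_genMl.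
- by rewrite rmorphM; exact: ideal_genMr.
Qed.

Lemma qmap_qpi (A B : pzRingType) (J : set A) (K : set B)
    (f : {rmorphism A -> B}) x :
  (forall x, J x -> ideal_gen K (f x)) ->
  qmap f (qpi J x) = qpi K (f x).
Proof.
move=> fJ; apply/qpiP; rewrite -rmorphB.
by apply: (rmorph_ideal_gen fJ); exact: qrepr_pi.
Qed.

Section CompletionTheory.
Variables (A : pzRingType) (J : nat -> set A).

(** [cproj] with the level first, so that each projection can carry a ring morphism structure. *)
Definition level (p : nat) (u : compl J) := cproj u p.

Fact level_is_zmod_morphism p : zmod_morphism (level p).
Proof. by move=> u v; rewrite /level cprojD cprojN. Qed.
Fact level_is_monoid_morphism p : monoid_morphism (level p).
Proof. by split=> [|u v]; rewrite /level ?cproj1 ?cprojM. Qed.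
HB.instance Definition _ p := GRing.isZmodMorphism.Build (compl J) (quot (J p))
  (level p) (level_is_zmod_morphism p).
HB.instance Definition _ p := GRing.isMonoidMorphism.Build (compl J) (quot (J p))
  (level p) (level_is_monoid_morphism p).

(** Stronger than convergence: the index from which the terms vanish is the level itself, so partial
    sums of explicit length compute each level. *)
Definition summable (f : nat -> compl J) : Prop :=
  forall p r, (p <= r)%N -> level p (f r) = 0.

Lemma level_sum_stable (f : nat -> compl J) p K :
  (forall r, (p <= r)%N -> level p (f r) = 0) -> (p <= K)%N ->
  level p (\sum_(r < K) f r) = level p (\sum_(r < p) f r).
Proof.
move=> sf pK; rewrite !rmorph_sum /=.
rewrite -(big_mkord xpredT (fun r => level p (f r))).
rewrite -[RHS](big_mkord xpredT (fun r => level p (f r))).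
rewrite (big_cat_nat (n := p)) //= [X in _ + X]big_nat_cond [X in _ + X]big1 ?addr0 // => r.
by rewrite andbT => /andP[pr _]; exact: sf.
Qed.

Fact csum_compatible (f : nat -> compl J) : summable f ->
  compatible (fun p => level p (\sum_(r < p) f r)).
Proof.
move=> sf p r pr.
have [x [h1 h2]] := cproj_compatible (\sum_(s < r) f s) pr.
exists x; rewrite -h2; split=> //; rewrite -h1.
by apply/esym/level_sum_stable => // s; exact: sf.
Qed.

(** [csum] picks some limit. The stable partial sums define a limit, so the pick is one too, and
    every limit agrees at level [p] with long partial sums. *)
Lemma level_csum (f : nat -> compl J) p K : summable f -> (p <= K)%N ->
  level p (csum f) = \sum_(r < K) level p (f r).
Proof.
move=> sf pK; pose s := Compl (csum_compatible sf).
have cs : converges_to f s.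
  by move=> q; exists q => r qr; apply: level_sum_stable => // ?; exact: sf.
have : converges_to f (csum f).
  by rewrite /csum; apply: (@xgetPex _ 0 [set s | converges_to f s]); exists s.
move=> /(_ p)[n0 h]; rewrite /level -(h (maxn n0 K) (leq_maxl _ _)).
rewrite -[LHS]/(level p _) level_sum_stable ?(leq_trans pK (leq_maxr _ _)) //; last first.
  by move=> r; exact: sf.
by rewrite -(level_sum_stable (K := K)) ?rmorph_sum // => r; exact: sf.
Qed.

End CompletionTheory.

Lemma level_csc (S : comPzRingType) (A : calgType S) (J : nat -> set A) p (s : S) :
  level p (csc s : compl J) = csc s.
Proof. by rewrite /level cproj_cin. Qed.

Lemma level_cin (A : pzRingType) (J : nat -> set A) p (x : A) :
  level p (cin J x) = qpi _ x.
Proof. exact: cproj_cin. Qed.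

Lemma qpi_csc (S : comPzRingType) (A : calgType S) (J : set A) (s : S) :
  qpi J (csc s) = csc s.
Proof. by []. Qed.

(** * Power series: shifts, truncation and units *)

Section FpsTheory.
Variable A : pzRingType.
Implicit Types (u v w : fps A) (a : A).

Fact fcst_is_zmod_morphism : zmod_morphism (@fcst A).
Proof.
by move=> a b; apply: fpsP => -[|i] /=; rewrite fcoD fcoN //= subr0.
Qed.
Fact fcst_is_monoid_morphism : monoid_morphism (@fcst A).
Proof.
split=> // a b; apply: fpsP => i; rewrite fcoM big_ord_recl /= subn0.
rewrite big1 ?addr0; last by move=> j _; rewrite mul0r.
by case: (i == 0%N); rewrite ?mulr0.
Qed.
HB.instance Definition _ :=
  GRing.isZmodMorphism.Build A (fps A) (@fcst A) fcst_is_zmod_morphism.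
HB.instance Definition _ :=
  GRing.isMonoidMorphism.Build A (fps A) (@fcst A) fcst_is_monoid_morphism.

Lemma fcoZ a u i : fco (fcst a * u) i = a * fco u i.
Proof.
rewrite fcoM big_ord_recl /= subn0 big1 ?addr0 // => j _.
by rewrite mul0r.
Qed.

Lemma fco_sum (I : Type) (s : seq I) (P : pred I) (F : I -> fps A) i :
  fco (\sum_(j <- s | P j) F j) i = \sum_(j <- s | P j) fco (F j) i.
Proof. by elim/big_rec2: _ => // j x y _ <-; rewrite fcoD. Qed.

Lemma fcoXM u i : fco (fX * u) i = if i is i'.+1 then fco u i' else 0.
Proof.
rewrite fcoM; case: i => [|i]; first by rewrite big_ord1 mul0r.
rewrite big_ord_recl mul0r add0r big_ord_recl /= mul1r subSS subn0.
by rewrite big1 ?addr0 // => j _; rewrite mul0r.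
Qed.

Definition fshift u : fps A := FPS (fun i => fco u i.+1).

Lemma fps_split u : u = fcst (fco u 0) + fX * fshift u.
Proof.
apply: fpsP => i; rewrite fcoD fcoXM; case: i => [|i] /=.
  by rewrite addr0.
by rewrite add0r.
Qed.

Lemma fX_inj u v : fX * u = fX * v -> u = v.
Proof. by move=> h; apply: fpsP => i; move: (congr1 (@fco _ ^~ i.+1) h); rewrite !fcoXM. Qed.

Lemma fco0M u v : fco (u * v) 0 = fco u 0 * fco v 0.
Proof. by rewrite fcoM big_ord1. Qed.

Lemma fco_exp_lt u j i : fco u 0 = 0 -> (i < j)%N -> fco (u ^+ j) i = 0.
Proof.
move=> u0; elim: j i => // j IH i; rewrite ltnS => ij.
rewrite exprS fcoM big_ord_recl u0 mul0r add0r big1 // => l _ /=.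
rewrite IH ?mulr0 //; apply: leq_trans ij.
by case: i l => [[]//|i l]; rewrite /bump /= add1n subSS ltnS leq_subr.
Qed.

Definition fgeom u : fps A := fcomp (fun=> 1) u.

Lemma fgeom_trunc u K i : fco u 0 = 0 -> (i < K)%N ->
  fco (fgeom u) i = fco (\sum_(j < K) u ^+ j) i.
Proof.
move=> u0 iK; rewrite fco_sum /= -(big_mkord xpredT (fun j => 1 * fco (u ^+ j) i)).
rewrite -(big_mkord xpredT (fun j => fco (u ^+ j) i)) [RHS](big_cat_nat (n := i.+1)) //=.
rewrite [X in _ = _ + X]big_nat_cond [X in _ = _ + X]big1 ?addr0; last first.
  by move=> j /andP[/andP[ij _] _]; apply: fco_exp_lt.
by apply: eq_bigr => j _; rewrite mul1r.
Qed.

Lemma fgeomP u : fco u 0 = 0 -> (1 - u) * fgeom u = 1.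
Proof.
move=> u0; apply: fpsP => i.
transitivity (fco ((1 - u) * \sum_(j < i.+1) u ^+ j) i).
  rewrite !fcoM; apply: eq_bigr => j _; congr (_ * _).
  by apply: fgeom_trunc => //; rewrite ltnS leq_subr.
(* The product telescopes to [1 - u ^+ i.+1], and [u ^+ i.+1] starts in a degree above [i]. *)
rewrite -[1 - u]opprB mulNr -subrX1 opprB fcoD fcoN fco_exp_lt // subr0.
by [].
Qed.

End FpsTheory.

(** Scaling by [a] makes the constant term 1; a geometric series then inverts
    [1 - (1 - u * fcst a)]. *)
Lemma fps_unit (A : comPzRingType) (u : fps A) (a : A) :
  fco u 0 * a = 1 -> exists v, u * v = 1.
Proof.
move=> ua; exists (fcst a * fgeom (1 - u * fcst a)); rewrite mulrA.
rewrite -{1}[u * fcst a](subKr 1); apply: fgeomP.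
by rewrite fcoD fcoN fco0M /= ua subrr.
Qed.

Lemma cscM (S : comPzRingType) (A : calgType S) (s t : S) :
  csc (s * t) = csc s * csc t :> A.
Proof. exact: rmorphM. Qed.

Lemma csc0 (S : comPzRingType) (A : calgType S) : csc 0 = 0 :> A.
Proof. exact: rmorph0. Qed.

Lemma csc1 (S : comPzRingType) (A : calgType S) : csc 1 = 1 :> A.
Proof. exact: rmorph1. Qed.

Lemma cscMACA (S : comPzRingType) (A : calgType S) (s t : S) (x y : A) :
  (csc s * x) * (csc t * y) = csc (s * t) * (x * y).
Proof. by rewrite cscM -!mulrA; congr (_ * _); rewrite !mulrA csc_central. Qed.

Lemma cscD (S : comPzRingType) (A : calgType S) (s t : S) :
  csc (s + t) = csc s + csc t :> A.
Proof. exact: rmorphD. Qed.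

Lemma cscX (S : comPzRingType) (A : calgType S) (s : S) j :
  csc (s ^+ j) = csc s ^+ j :> A.
Proof. exact: rmorphXn. Qed.

Lemma level_inj (A : pzRingType) (J : nat -> set A) (u v : compl J) :
  (forall p, level p u = level p v) -> u = v.
Proof. exact: complP. Qed.

Lemma levelM (A : pzRingType) (J : nat -> set A) p (u v : compl J) :
  level p (u * v) = level p u * level p v.
Proof. exact: cprojM. Qed.

(** * Homomorphisms from a topologically free algebra *)

Section FreeSeries.
Variables (R : realType) (X : choiceType).
Local Notation C := (R[i]%C).
Local Notation free := (freeser R X).

Lemma csc_cC (c : C) : csc (cC c) = fcst (fcst c%:MP) :> free.
Proof.
rewrite -[LHS]/(freeser_csc X (cC c)) freeser_cscE.
by apply: fpsP => -[|i]; apply: fpsP => -[|j] //=; rewrite !malgC0E.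
Qed.

Lemma csc_hbar1 : csc hbar1 = fcst fX :> free.
Proof.
rewrite -[LHS]/(freeser_csc X hbar1) freeser_cscE.
by apply: fpsP => -[|i]; apply: fpsP => -[|[|j]] //=; rewrite ?malgC0E ?malgC1E.
Qed.

Lemma csc_hbar2 : csc hbar2 = fX :> free.
Proof.
rewrite -[LHS]/(freeser_csc X hbar2) freeser_cscE.
by apply: fpsP => -[|[|i]]; apply: fpsP => -[|j] //=; rewrite ?malgC0E ?malgC1E.
Qed.

(** Multiplication by [hbar2] only shifts coefficients in the completed free algebra; this makes
    quotients by [q - q^-1] unique there. *)
Lemma hbar2_inj (u v : free) : csc hbar2 * u = csc hbar2 * v -> u = v.
Proof. by rewrite csc_hbar2; exact: fX_inj. Qed.

Definition fword (w : seq X) : free := \prod_(x <- w) fgen R x.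

Lemma fwordE w : fword w = fcst (fcst << FMonom w >>).
Proof.
rewrite /fword; elim: w => [|x w IH].
  by rewrite big_nil -[FMonom [::]]fmE.
rewrite big_cons IH fgenE -!rmorphM /= -[FMonom (x :: w)]fmE; congr (fcst (fcst _)).
rewrite [LHS]malgM_def [LHS]fgmulUU mulr1; congr << _ *g _ >>.
by apply: val_inj; rewrite /= fmM fmU fmE.
Qed.

(** A series constant in both variables is a finite combination of words, so scalars and generators
    determine a ring homomorphism on it without any topology. *)
Lemma malg_words (g : {malg C[{fmonom X}]}) :
  exists s : seq (C * seq X), fcst (fcst g) = \sum_(t <- s) csc (cC t.1) * fword t.2 :> free.
Proof.
exists [seq (g@_w, fmonom_val w) | w <- finmap.enum_fset (msupp g)].
rewrite big_map [in LHS](monalgE g).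
rewrite !rmorph_sum /=; apply: eq_bigr => w _.
rewrite fwordE csc_cC -!rmorphM /=; congr (fcst (fcst _)).
by case: w => w /=; rewrite [RHS]malgM_def [RHS]fgmulUU mulr1 mul1m.
Qed.

Variables (A : calgType (Ch R)) (J : nat -> set A).
Hypothesis hbar2_eq0 : csc hbar2 = 0 :> A.
Hypothesis hbar1_level : forall p, ideal_gen (J p) (csc (hbar1 ^+ p)).

Lemma freeser_rmorph_ext (F G : {rmorphism free -> compl J}) :
  (forall s, F (csc s) = csc s) -> (forall s, G (csc s) = csc s) ->
  (forall x, F (fgen R x) = G (fgen R x)) -> F =1 G.
Proof.
move=> Fs Gs FG.
have h2 : csc hbar2 = 0 :> compl J.
  by rewrite -[LHS]/(cin J _) hbar2_eq0 rmorph0.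
have FGc g : F (fcst (fcst g)) = G (fcst (fcst g)).
  have [s ->] := malg_words g.
  rewrite !rmorph_sum; apply: eq_bigr => t _; rewrite !rmorphM Fs Gs; congr (_ * _).
  by rewrite /fword !rmorph_prod; apply: eq_bigr.
(* The forced continuity: constant terms agree, so the difference at [w] is [hbar1] times the
   difference at the shifted series, and this can be repeated [p] times. *)
have FG1 p w : exists z, F (fcst w) - G (fcst w) = csc (hbar1 ^+ p) * z.
  elim: p w => [|p IH] w; first by exists (F (fcst w) - G (fcst w)); rewrite rmorph1 mul1r.
  have [z hz] := IH (fshift w); exists z.
  rewrite [in LHS](fps_split w) rmorphD (rmorphM (@fcst _)) /= -csc_hbar1.
  rewrite !rmorphD !rmorphM Fs Gs FGc opprD addrACA subrr add0r -mulrBr hz.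
  by rewrite exprS [in RHS]rmorphM /= mulrA.
(* As [hbar2] maps to 0, only the coefficient of degree 0 in [hbar2] matters. *)
have cst (H : {rmorphism free -> compl J}) u :
    (forall s, H (csc s) = csc s) -> H u = H (fcst (fco u 0)).
  move=> Hs; rewrite [in LHS](fps_split u) -csc_hbar2 rmorphD rmorphM Hs h2.
  by rewrite mul0r addr0.
move=> u; apply: complP => p; apply/eqP; rewrite -subr_eq0; apply/eqP.
rewrite -[LHS]/(level p (F u) - level p (G u)) -(raddfB (level p)) (cst F) // (cst G) //.
have [z ->] := FG1 p (fco u 0).
rewrite [LHS](rmorphM (level p)) /= level_csc -qpi_csc (_ : qpi _ _ = 0) ?mul0r //.
exact/qpi_eq0.
Qed.

End FreeSeries.

(** * The homomorphism Phi modulo hbar_2 *)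

Section GroundRingTheory.
Variable R : realType.
Local Notation C := (R[i]%C).

Fact cC_is_zmod_morphism : zmod_morphism (@cC R).
Proof. by move=> a b; rewrite /cC !rmorphB. Qed.
Fact cC_is_monoid_morphism : monoid_morphism (@cC R).
Proof. by split=> [|a b]; rewrite /cC ?rmorph1 // !rmorphM. Qed.
HB.instance Definition _ :=
  GRing.isZmodMorphism.Build C (Ch R) (@cC R) cC_is_zmod_morphism.
HB.instance Definition _ :=
  GRing.isMonoidMorphism.Build C (Ch R) (@cC R) cC_is_monoid_morphism.

Lemma cC1 : cC 1 = 1 :> Ch R. Proof. exact: rmorph1. Qed.

Lemma csc_mod_hbar2 (B : calgType (Ch R)) (s : Ch R) :
  csc hbar2 = 0 :> B -> csc s = csc (fcst (red2 s)) :> B.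
Proof.
by move=> h2; rewrite [in LHS](fps_split s) rmorphD rmorphM /= h2 mul0r addr0.
Qed.

(** In degree 0 of [hbar2] a substituted series keeps only its term [j = 0], here
    [sqrt1p_co 0 = 1]. *)
Lemma red2_sqrt_factor m : red2 (sqrt_factor R m) = 1.
Proof.
by rewrite /red2 /= big_ord1 expr0 /sqrt1p_co big_ord0 divr1 mulr1 rmorph1.
Qed.

(** The witness is [hbar_2 / (q - q^-1)]. As [q = exp (hbar_2 / 2m)], the series [q - q^-1] starts
    with [hbar_2 / m]; removing one [hbar_2] leaves a unit with constant term [1 / m]. *)
Lemma qq_quot (m : nat) : (0 < m)%N ->
  exists2 s : Ch R, qq R m * s = hbar2 & red2 s = fcst m%:R.
Proof.
move=> m0; have m0' : m%:R != 0 :> C by rewrite pnatr_eq0 -lt0n.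
have qq0 : fco (qq R m) 0 = 0.
  apply: fpsP => i; rewrite fcoD fcoN /= fcoD fcoN /=.
  by rewrite !expr0 subrr.
have qq1 : fco (qq R m) 1 = fcst m%:R^-1.
  apply: fpsP => i; rewrite fcoD fcoN /= fcoD fcoN /=.
  case: i => [|i] /=; last by rewrite exprS !mul0r subrr.
  rewrite expr0 divr1 !mul1r !expr1 !divr1 mulrN1z mulNr opprK div1r natrM.
  by rewrite invfM mulrC -splitr.
have qqE : qq R m = fX * fshift (qq R m).
  by rewrite [LHS]fps_split qq0 rmorph0 add0r.
have u1 : fco (fshift (qq R m)) 0 * fcst m%:R = 1.
  by rewrite /= qq1 -rmorphM mulVf ?rmorph1.
have [v uv] := fps_unit u1; exists v; first by rewrite qqE -mulrA uv mulr1.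
move: (congr1 (fun s => fcst m%:R * fco s 0) uv).
by rewrite fco0M mulrA [fcst m%:R * _]mulrC u1 mul1r mulr1.
Qed.

End GroundRingTheory.

Lemma ideal_gen_deg_ge (R : realType) (A : calgType (Ch R)) (G : Type) (g : G -> A)
    (deg : G -> nat) p a b (w : seq G) :
  (p <= a + b + \sum_(y <- w) deg y)%N ->
  ideal_gen (deg_ge g deg p) (csc (hbar1 ^+ a * hbar2 ^+ b) * \prod_(y <- w) g y).
Proof. by move=> h; apply: sub_ideal_gen; rewrite /deg_ge /mkset; exists a, b, w. Qed.

Lemma fcst_csc_central (S : comPzRingType) (A : calgType S) (s : S) (u : fps A) :
  fcst (csc s) * u = u * fcst (csc s).
Proof.
apply: fpsP => i; rewrite fcoZ [RHS]fco_mul_rev big_ord_recl /= subn0 csc_central.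
by rewrite big1 ?addr0 // => j _; rewrite mulr0.
Qed.

Section PhiModHbar2.
Variables (R : realType) (m n : nat) (ko : int).
Hypotheses (m_gt0 : (0 < m)%N) (n_gt0 : (0 < n)%N).
Local Notation C := (R[i]%C).
Local Notation N := (m * n)%N.
Local Notation omega := (omega R m n ko).
Local Notation Yhat := (yangian_hat R N).
Local Notation free := (freeser R (Ygen N)).
Local Notation ydeg_ge := (deg_ge (@yangian_gen R N) (@Ydeg N)).
Local Notation toY := (@to_Yhat R m n).

Fact to_Yhat_is_zmod_morphism : zmod_morphism toY.
Proof. by move=> u v; rewrite /to_Yhat !rmorphB. Qed.
Fact to_Yhat_is_monoid_morphism : monoid_morphism toY.
Proof. by split=> [|u v]; rewrite /to_Yhat ?rmorph1 // !rmorphM. Qed.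
HB.instance Definition _ :=
  GRing.isZmodMorphism.Build free Yhat toY to_Yhat_is_zmod_morphism.
HB.instance Definition _ :=
  GRing.isMonoidMorphism.Build free Yhat toY to_Yhat_is_monoid_morphism.

Lemma to_Yhat_cscM s u : toY (csc s * u) = csc s * toY u.
Proof. by rewrite rmorphM. Qed.

Lemma level_hbar2 q j : (q <= j)%N -> level q (csc (hbar2 ^+ j) : Yhat) = 0.
Proof.
move=> qj; rewrite level_csc -qpi_csc; apply/qpi_eq0.
have := @ideal_gen_deg_ge _ _ _ (@yangian_gen R N) (@Ydeg N) q 0 j [::].
by rewrite !big_nil expr0 mul1r mulr1 addn0; apply.
Qed.

Lemma summable_gen (y : nat -> Ygen N) :
  (forall r, Ydeg (y r) = r) -> summable (fun r => Yhat_gen R (y r)).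
Proof.
move=> yr q r qr; rewrite level_cin; apply/qpi_eq0.
have := @ideal_gen_deg_ge _ _ _ (@yangian_gen R N) (@Ydeg N) q 0 0 [:: y r].
by rewrite !big_seq1 !expr0 mulr1 rmorph1 mul1r yr; apply.
Qed.

Lemma summableMl (S : pzRingType) (J : nat -> set S) (f g : nat -> compl J) :
  summable g -> summable (fun r => f r * g r).
Proof. by move=> sg q r qr; rewrite rmorphM /= (sg q r qr) mulr0. Qed.

Lemma to_Yhat_sum k (F : 'I_k -> free) : toY (\sum_(i < k) F i) = \sum_(i < k) toY (F i).
Proof. exact: rmorph_sum. Qed.

(** The series [(xi_i(z) - 1) / hbar_2] in [z^-1]. *)
Definition xi_series (i : 'I_N) : fps free :=
  FPS (fun r : nat => if r is r'.+1
    then csc (cC N%:R^-1) * fgen R (Yxi i r') else 0).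

(** The element [t_{i,r} / hbar_2]: the logarithm has no term of exponent 0, so the exponents run
    over [j.+1] and one factor [hbar_2] is removed from each term. *)
Definition tdiv (i : 'I_N) (r : nat) : free :=
  \sum_(j < r.+1) csc (cC (log1p_co j.+1) * hbar2 ^+ j)
                  * fco (xi_series i ^+ j.+1) r.+1.

Lemma tfreeE i r : tfree R i r = csc hbar2 * tdiv i r.
Proof.
rewrite /tfree /logxi.
rewrite (_ : FPS _ = fcst (csc hbar2) * xi_series i); last first.
  apply: fpsP => -[|s]; rewrite fcoZ /= ?mulr0 //.
  by rewrite /cscale mulrA -rmorphM [hbar2 * _]mulrC.
rewrite /= big_ord_recl /= !rmorph0 mul0r add0r mulr_sumr.
apply: eq_bigr => j _; rewrite exprMn_comm; last first.
  exact: fcst_csc_central.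
rewrite -rmorphXn fcoZ !mulrA -!rmorphXn -!rmorphM; congr (csc _ * _).
by rewrite [RHS]mulrCA exprS.
Qed.

(** The coefficient of [z^-s] in the [j]-th power sums products of [j] generators [xi_{i,a}] with
    the [a + 1] adding up to [s], hence of degree [s - j]. The word [w] collects the generators
    already peeled off, which lets the induction on [j] go through. *)
Lemma xi_series_deg i j s b (w : seq (Ygen N)) q :
  (q <= b + \sum_(y <- w) Ydeg y + (s - j))%N ->
  ideal_gen (ydeg_ge q)
    (csc (hbar2 ^+ b) * \prod_(y <- w) yangian_gen R y
     * qpi _ (fco (xi_series i ^+ j) s)).
Proof.
elim: j s w => [|j IH] s w hq.
  rewrite expr0; case: s hq => [|s] hq; last by rewrite rmorph0 mulr0; exact: ideal_gen0.
  rewrite rmorph1 mulr1 -[hbar2 ^+ b]mul1r -(expr0 hbar1).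
  by apply: ideal_gen_deg_ge; lia.
rewrite exprS fcoM rmorph_sum mulr_sumr; apply: ideal_gen_sum => -[[|a] /= as1] _.
  by rewrite mul0r rmorph0 mulr0; exact: ideal_gen0.
rewrite !rmorphM /= !mulrA qpi_csc -[_ * csc _]csc_central -!mulrA; apply: ideal_genMl.
have := IH (s - a.+1)%N (rcons w (Yxi i a)).
rewrite -cats1 !big_cat !big_seq1 /= !mulrA; apply.
lia.
Qed.

Lemma summable_tdiv i : summable (fun r => toY (tdiv i r)).
Proof.
move=> q r qr; rewrite level_cin; apply/qpi_eq0; rewrite rmorph_sum.
apply: ideal_gen_sum => j _; rewrite rmorphM /= qpi_csc rmorphM -mulrA; apply: ideal_genMl.
have := @xi_series_deg i j.+1 r.+1 j [::] q; rewrite !big_nil mulr1; apply.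
by have := ltn_ord j; lia.
Qed.

(** [fquot] only chooses a quotient [c]. Multiplying [c * qq = tfree] by [s] gives
    [hbar2 * c = hbar2 * (tdiv * s)], and [hbar2] cancels, so the choice is forced. *)
Lemma fquot_tfree i r (s : Ch R) : qq R m * s = hbar2 ->
  fquot (tfree R i r) (csc (qq R m)) = tdiv i r * csc s.
Proof.
move=> qs; rewrite /fquot; case: xgetP => [c _ /= hc|/(_ (tdiv i r * csc s))]; last first.
  by case=> /=; rewrite tfreeE -mulrA -rmorphM mulrC qs /= csc_central.
apply: hbar2_inj; rewrite mulrA -tfreeE -hc -mulrA -rmorphM qs.
by rewrite csc_central.
Qed.

Lemma csum_scale (c : nat -> Ch R) (s : Ch R) (f : nat -> Yhat) : summable f ->
  csum (fun r => csc (c r) * (csc s * f r))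
  = csc s * csum (fun r => csc (c r) * f r).
Proof.
move=> sf; apply: complP => q; rewrite cprojM -!/(level q _).
rewrite !(@level_csum _ _ _ q q) ?leqnn //; last 2 first.
- exact: summableMl.
- by apply: summableMl; apply: summableMl.
rewrite mulr_sumr; apply: eq_bigr => r _.
rewrite -[RHS]rmorphM; congr (level q _).
by rewrite !mulrA [csc s * _]csc_central.
Qed.

Definition gamma_div (i j : 'I_N) : fps Yhat :=
  FPS (fun p => - csum (fun r =>
    csc (cC ((-1) ^+ r / (r`!)%:R * fco (iter r.+1 (@fderiv C) (GY R ko i j)) p))
    * toY (tdiv j r))).

Lemma gammaYE (i j : 'I_N) : gammaY R ko i j = fcst (csc hbar2) * gamma_div i j.
Proof.
apply: fpsP => p; rewrite fcoZ /= mulrN -csum_scale; last exact: summable_tdiv.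
congr (- csum _); apply/funext => r /=.
by rewrite /cscale /tY tfreeE to_Yhat_cscM.
Qed.

Lemma half_gammaE (i : 'I_N) : exists g, half_gamma R ko i = fcst (csc hbar2) * g.
Proof.
exists (fcst (csc (cC 2^-1)) * \sum_(j < N | j == i %[mod m]) gamma_div i j).
rewrite /half_gamma [RHS]mulrA [fcst _ * fcst _]fcst_csc_central -mulrA; congr (_ * _).
by rewrite mulr_sumr; apply: eq_bigr => j _; exact: gammaYE.
Qed.

(** * Homomorphisms out of the completed Yangian that factor through level [p] and kill [hbar_2] *)

Variables (B : calgType (Ch R)) (V : {rmorphism Yhat -> B}) (p : nat).
Hypotheses (hbar2_eq0 : csc hbar2 = 0 :> B) (V_csc : forall s, V (csc s) = csc s).
Hypothesis V_level : forall y, level p y = 0 -> V y = 0.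

(** The sum and its truncation agree at level [p], and [V] sees nothing beyond that level. *)
Lemma V_csum f K : summable f -> (p <= K)%N -> V (csum f) = \sum_(r < K) V (f r).
Proof.
move=> sf pK; apply/eqP; rewrite -subr_eq0 -rmorph_sum -rmorphB; apply/eqP.
apply: V_level; rewrite raddfB /= (level_csum sf pK) rmorph_sum /=.
by rewrite subrr.
Qed.

(** Only the linear term of the logarithm survives; all later ones still carry a factor [hbar_2]. *)
Lemma V_tdiv i r : V (toY (tdiv i r)) = csc (cC N%:R^-1) * V (Yhat_gen R (Yxi i r)).
Proof.
rewrite /tdiv to_Yhat_sum rmorph_sum big_ord_recl big1 ?addr0; last first.
  move=> j _; rewrite lift0 [hbar2 ^+ _]exprS mulrCA [csc _]rmorphM -mulrA.
  by rewrite to_Yhat_cscM rmorphM V_csc hbar2_eq0 mul0r.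
rewrite expr0 mulr1 expr1 /= expr0 divr1 !rmorph1 mul1r to_Yhat_cscM.
by rewrite rmorphM V_csc.
Qed.

Lemma V_Bqq (i : 'I_N) (w : C) : V (Bqq i w) =
  \sum_(r < p.+1) csc (cC (w ^+ r / (r`!)%:R))
                  * (csc (cC n%:R^-1) * V (Yhat_gen R (Yxi i r))).
Proof.
have [s qs s0] := qq_quot R m_gt0.
rewrite /Bqq (_ : (fun r => _) = fun r =>
    csc (cC (w ^+ r / (r`!)%:R)) * (csc s * toY (tdiv i r))); last first.
  by apply/funext => r; rewrite (fquot_tfree _ _ qs) -csc_central to_Yhat_cscM.
rewrite (@V_csum _ p.+1) //; last first.
  by apply: summableMl; apply: summableMl; exact: summable_tdiv.
apply: eq_bigr => r _; rewrite !rmorphM !V_csc V_tdiv; congr (_ * _).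
(* Modulo [hbar_2] the factor [hbar_2 / (q - q^-1)] is [m], which turns [1 / mn] into [1 / n]. *)
rewrite mulrA [csc s]csc_mod_hbar2 // s0 -rmorphM; congr (csc _ * _).
rewrite -[fcst _]/(cC m%:R) -rmorphM natrM invfM mulrA mulfV ?mul1r //.
by rewrite pnatr_eq0 -lt0n.
Qed.

(** The exponent is a multiple of [hbar_2], so its [j]-th power is one of [hbar_2 ^ j]. This makes
    the exponential summable, and leaves only its term [j = 0] modulo [hbar_2]. *)
Lemma V_gY (i : 'I_N) s : V (fco (gY R ko i) s) = (s == 0%N)%:R.
Proof.
have [g hg] := half_gammaE i.
have gX j t : fco (half_gamma R ko i ^+ j) t = csc (hbar2 ^+ j) * fco (g ^+ j) t.
  rewrite hg exprMn_comm; last exact: fcst_csc_central.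
  by rewrite -rmorphXn fcoZ rmorphXn.
rewrite /= rmorphM V_csc csc_mod_hbar2 // (@V_csum _ p.+1) //; last first.
  apply: summableMl => q r qr; rewrite gX rmorphM /=.
  by rewrite level_hbar2 // mul0r.
rewrite big_ord_recl [X in _ + X]big1 ?addr0; last first.
  move=> j _; rewrite /cscale gX lift0 exprS !(rmorphM V) !V_csc.
  by rewrite [csc (hbar2 * _)]cscM hbar2_eq0 !mul0r mulr0.
rewrite red2_sqrt_factor -[fcst 1]/(1 : Ch R) csc1 mul1r /exp_co invr1 expr0.
rewrite /cscale (rmorphM V) V_csc cC1 csc1 mul1r.
by case: s => [|s]; [exact: rmorph1|exact: rmorph0].
Qed.

Lemma V_gkY k (i : 'I_N) r : V (gkY R ko k i r) = csc (cC ((k%:~R * n%:R) ^+ r / (r`!)%:R)).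
Proof.
rewrite /gkY fcoM rmorph_sum big_ord_recr /= subnn rmorphM V_gY mulr1 V_csc.
rewrite big1 ?add0r // => j _; rewrite rmorphM V_gY.
by rewrite subn_eq0 leqNgt ltn_ord mulr0.
Qed.

Definition Ygen_over (x : Ugen m) (i' : 'I_N) (r : nat) : Ygen N :=
  match x with
  | Ue _ _ => Yx true i' r
  | Uf _ _ => Yx false i' r
  | Uh _ _ => Yxi i' r
  end.
Definition Ugen_vertex (x : Ugen m) : 'I_m :=
  match x with Ue i _ | Uf i _ | Uh i _ => i end.
Definition Ugen_mode (x : Ugen m) : int :=
  match x with Ue _ k | Uf _ k | Uh _ k => k end.

(** Modulo [hbar_2] the three kinds of generators obey one formula. Sums stop at [p.+1] and not at
    [p], so that the term [r = 0] is present even for [p = 0]. *)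
Lemma V_Phi_val x : V (Phi_val R n ko x) =
  \sum_(i' < N | i' == Ugen_vertex x %[mod m])
    csc (cC (omega ^ (- (Ugen_mode x * i'%:Z))))
    * \sum_(r < p.+1) csc (cC (((Ugen_mode x)%:~R * n%:R) ^+ r / (r`!)%:R))
                      * V (Yhat_gen R (Ygen_over x i' r)).
Proof.
have Vx b i k : V (Phi_x R n ko b i k) =
    \sum_(i' < N | i' == i %[mod m]) csc (cC (omega ^ (- (k * i'%:Z))))
    * \sum_(r < p.+1) csc (cC ((k%:~R * n%:R) ^+ r / (r`!)%:R))
                      * V (Yhat_gen R (Yx b i' r)).
  rewrite rmorph_sum; apply: eq_bigr => i' _; rewrite rmorphM V_csc.
  rewrite (@V_csum _ p.+1) //; last by apply: summableMl; exact: summable_gen.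
  by congr (_ * _); apply: eq_bigr => r _; rewrite rmorphM V_gkY.
case: x => [i k|i k|i k] /=; [exact: Vx|exact: Vx|].
(* In mode 0 the coefficients [0 ^+ r] leave only [r = 0], which recovers the separate value of
   [Phi_val] on [h_{i,0}]. *)
case: eqP => [->|k0]; rewrite rmorph_sum; apply: eq_bigr => i' _ /=.
  rewrite mul0r oppr0 expr0z rmorph1 mul1r big_ord_recl big1 ?addr0.
    by rewrite expr0 divr1 !rmorph1 mul1r.
  by move=> r _; rewrite mul0r exprS mul0r mul0r !rmorph0 mul0r.
rewrite rmorphM V_csc V_Bqq [n%:R * _]mulrC !rmorphM -mulrA; congr (_ * _).
rewrite mulr_sumr; apply: eq_bigr => r _.
rewrite !mulrA -!rmorphM; congr (csc (cC _) * _).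
by rewrite mulrAC mulfV ?mul1r // pnatr_eq0 -lt0n.
Qed.

End PhiModHbar2.

(** * Difference operators inside differential operators *)

Section Omega.
Variable R : realType.
Local Notation C := (R[i]%C).

Lemma expiD (s t : R) : expi (s + t) = expi s * expi t.
Proof.
rewrite /expi cosD sinD; apply/eqP; rewrite eq_complex /= eqxx /= addrC.
by rewrite [cos s * _]mulrC [sin s * _]mulrC.
Qed.

Lemma expi0 : expi 0 = 1 :> C.
Proof. by rewrite /expi cos0 sin0. Qed.

Lemma expi_neq0 (t : R) : expi t != 0.
Proof.
apply/eqP => t0; have := expiD t (- t); rewrite t0 mul0r subrr expi0.
by move/eqP; rewrite oner_eq0.
Qed.

Lemma expiMn (t : R) j : expi (t *+ j) = expi t ^+ j.
Proof. by elim: j => [|j IH]; rewrite ?expi0 // mulrS expiD IH exprS. Qed.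

Lemma expi_2pi (k : int) : expi (2 * pi * k%:~R) = 1 :> C.
Proof.
have e1 j : expi (2 * pi * j%:R) = 1 :> C.
  rewrite mulr_natr expiMn /expi mulr_natl cos2pi sin2pi.
  by rewrite (_ : (1 +i* 0)%C = 1) ?expr1n.
case: k => j; first exact: e1.
rewrite NegzE mulrNz mulrN; apply: (mulfI (expi_neq0 (2 * pi * j.+1%:R))).
by rewrite -expiD subrr expi0 e1 mulr1.
Qed.

Variables (m n : nat) (ko : int).
Hypotheses (m_gt0 : (0 < m)%N) (n_gt0 : (0 < n)%N).

Lemma omega_neq0 : omega R m n ko != 0.
Proof. exact: expi_neq0. Qed.

Lemma omega_mn : omega R m n ko ^+ (m * n) = 1.
Proof.
rewrite -expiMn -[_ *+ (m * n)]mulr_natr divfK ?expi_2pi //.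
by rewrite pnatr_eq0 -lt0n muln_gt0 m_gt0.
Qed.

End Omega.

(** * Truncated exponentials *)

Lemma sum_antidiag (V : zmodType) K (T : nat -> nat -> V) :
  (forall i j, (K <= i + j)%N -> T i j = 0) ->
  \sum_(r < K) \sum_(i < r.+1) T (r - i)%N i = \sum_(i < K) \sum_(j < K) T i j.
Proof.
move=> T0; rewrite [RHS]exchange_big /=.
transitivity (\sum_(r < K) \sum_(i < K | (i <= r)%N) T (r - i)%N i).
  apply: eq_bigr => r _.
  by rewrite (big_ord_widen K (fun i => T (r - i)%N i)) // ltn_ord.
rewrite (exchange_big_dep xpredT) //=; apply: eq_bigr => i _.
rewrite -(big_geq_mkord i K xpredT (fun r => T (r - i)%N i)).
rewrite -{1}[nat_of_ord i]add0n big_addn big_mkord.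
rewrite (big_ord_widen K (fun j => T (j + i - i)%N i)) ?leq_subr // big_mkcond.
apply: eq_bigr => j _; rewrite addnK; case: ltnP => // ij.
(* What the square has beyond the triangle [i + j < K] vanishes. *)
by rewrite T0 //; lia.
Qed.

Definition Texp (R : realType) (B : calgType (Ch R)) (K : nat) (x : B) : B :=
  \sum_(r < K) csc (cC (r`!)%:R^-1) * x ^+ r.

Section TruncatedExp.
Variables (R : realType) (B : calgType (Ch R)) (K : nat).
Implicit Types x y : B.

(** The binomial formula gives the part of the product with [i + j < K]; the second hypothesis kills
    the rest. *)
Lemma TexpD x y : x * y = y * x ->
  (forall i j, (K <= i + j)%N -> x ^+ i * y ^+ j = 0) ->
  Texp K (x + y) = Texp K x * Texp K y.
Proof.
move=> xy xy0; rewrite /Texp.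
pose T i j := csc (cC ((i`!)%:R^-1 * (j`!)%:R^-1)) * (x ^+ i * y ^+ j).
transitivity (\sum_(i < K) \sum_(j < K) T i j); last first.
  rewrite mulr_suml; apply: eq_bigr => i _; rewrite mulr_sumr; apply: eq_bigr => j _.
  rewrite /T rmorphM cscM -!mulrA; congr (_ * _).
  by rewrite mulrA csc_central -mulrA.
rewrite -sum_antidiag; last by move=> i j /xy0; rewrite /T => ->; rewrite mulr0.
apply: eq_bigr => r _; rewrite exprDn_comm // mulr_sumr; apply: eq_bigr => i _.
have natE k : k%:R = csc (cC k%:R) :> B by rewrite !rmorph_nat.
rewrite /T -[(_ * _) *+ _]mulr_natl [LHS]mulrA; congr (_ * _).
rewrite natE -cscM -(rmorphM (@cC R)); congr (csc (cC _)).
have ir : (i <= r)%N by rewrite -ltnS.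
rewrite -(bin_fact ir) !natrM.
have f0 k : (k`!)%:R != 0 :> R[i]%C by rewrite pnatr_eq0 -lt0n fact_gt0.
have c0 : 'C(r, i)%:R != 0 :> R[i]%C by rewrite pnatr_eq0 -lt0n bin_gt0.
by field; rewrite !f0 c0.
Qed.

Lemma Texp0 : (0 < K)%N -> Texp K (0 : B) = 1.
Proof.
case: K => // K' _; rewrite /Texp big_ord_recl expr0 invr1 cC1 csc1 mulr1.
by rewrite big1 ?addr0 // => j _; rewrite expr0n mulr0.
Qed.

End TruncatedExp.

Lemma ideal_pow_prod (A : pzRingType) (J : set A) p (s : seq A) :
  (forall x, x \in s -> ideal_gen J x) -> (p <= size s)%N ->
  ideal_gen (ideal_pow J p) (\prod_(x <- s) x).
Proof.
move=> sJ ps; rewrite -(cat_take_drop p s) big_cat /=; apply: ideal_genMr.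
apply: sub_ideal_gen; rewrite /ideal_pow /mkset.
have st : size (take p s) == p by rewrite size_takel.
exists (Tuple st); split=> // i; apply: sJ; apply: (@mem_take p).
exact: mem_tnth.
Qed.

Lemma ideal_pow_expM (A : pzRingType) (J : set A) p (x y : A) i j :
  ideal_gen J x -> ideal_gen J y -> (p <= i + j)%N ->
  ideal_gen (ideal_pow J p) (x ^+ i * y ^+ j).
Proof.
move=> Jx Jy pij; have := @ideal_pow_prod _ J p (nseq i x ++ nseq j y).
rewrite big_cat !big_nseq -!Monoid.iteropE size_cat !size_nseq; apply=> // z.
by rewrite mem_cat !mem_nseq => /orP[]/andP[_ /eqP ->].
Qed.

(** Taylor expansion with remainder: it links [hexp], given by coefficients, with truncated
    exponentials. *)
Lemma Ch1_trunc (R : realType) K (w : Ch1 R) :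
  exists w', fcst w = \sum_(r < K) cC (fco w r) * hbar1 ^+ r + hbar1 ^+ K * fcst w' :> Ch R.
Proof.
elim: K w => [|K IH] w; first by exists w; rewrite big_ord0 add0r expr0 mul1r.
have [w' hw] := IH (fshift w); exists w'.
rewrite [in LHS](fps_split w) rmorphD rmorphM /= -[fcst fX]/hbar1 hw.
rewrite mulrDr addrA big_ord_recl expr0 mulr1 exprS -mulrA; congr (_ + _ + _).
by rewrite mulr_sumr; apply: eq_bigr => r _; rewrite lift0 exprS mulrCA.
Qed.

Lemma pres_rel (R : realType) (X : choiceType) (rels : set (freeser R X)) u :
  rels u -> qpi (closed_ideal rels) u = 0.
Proof.
move=> ru; apply/qpi_eq0; apply: sub_ideal_gen; rewrite /closed_ideal /mkset => p.
by exists u => //; exact: sub_ideal_gen.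
Qed.

(* [exp (a hbar_1 + c partial)], sealed to keep conversion away from its body *)
HB.lock Definition expd (R : realType) (a c : R[i]%C) : dop_hat R :=
  csc (hexp a 0) * exp_partial c.

Section ExpPartial.
Variable R : realType.
Local Notation C := (R[i]%C).
Local Notation dop := (dop R).
Local Notation Dhat := (dop_hat R).
Local Notation dquot p := (quot (ideal_pow (@dop_J R) p)).

Lemma dop_hbar2_eq0 : csc hbar2 = 0 :> dop.
Proof. exact: (pres_rel (dop_hbar2 R)). Qed.

Lemma dquot_hbar2_eq0 p : csc hbar2 = 0 :> dquot p.
Proof. rewrite -qpi_csc dop_hbar2_eq0; exact: rmorph0. Qed.

(** These elements commute and lie in the ideal [(partial, hbar_1)], so [exp (c partial)] and
    [exp (a hbar_1)] become two cases of one additive exponential. *)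
Definition dlin (a c : C) : dop := csc (cC c) * partial R + csc (cC a * hbar1).

Lemma csc_hbar1_dop_J a : ideal_gen (@dop_J R) (csc (cC a * hbar1)).
Proof. by rewrite cscM; apply: ideal_genMl; apply: sub_ideal_gen; right. Qed.

Lemma dlin_dop_J a c : ideal_gen (@dop_J R) (dlin a c).
Proof.
apply: ideal_genD; last exact: csc_hbar1_dop_J.
by apply: ideal_genMl; apply: sub_ideal_gen; left.
Qed.

Lemma dlin_comm a c a' c' : dlin a c * dlin a' c' = dlin a' c' * dlin a c.
Proof.
have xs (x : dop) s : GRing.comm x (csc s) by rewrite /GRing.comm csc_central.
have cp : GRing.comm (csc (cC c) * partial R) (csc (cC c') * partial R).
  by rewrite /GRing.comm !cscMACA mulrC.
by apply: commrD => //; apply/commr_sym/commrD => //; exact: commr_sym.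
Qed.

Lemma Texp_dlinD p a c a' c' :
  Texp p.+1 (qpi (ideal_pow (@dop_J R) p) (dlin (a + a') (c + c')))
  = Texp p.+1 (qpi _ (dlin a c)) * Texp p.+1 (qpi _ (dlin a' c')).
Proof.
rewrite -TexpD; last 2 first.
- by rewrite -!rmorphM /= dlin_comm.
- move=> i j ij; rewrite -!rmorphXn -rmorphM; apply/qpi_eq0.
  by apply: ideal_pow_expM; [exact: dlin_dop_J|exact: dlin_dop_J|exact: ltnW].
congr (Texp _ _); rewrite -rmorphD; congr (qpi _ _).
by rewrite /dlin addrACA !(rmorphD (@cC R)) /= !(cscD, mulrDl).
Qed.

Lemma level_exp_partial p c :
  level p (exp_partial c) = Texp p.+1 (qpi _ (dlin 0 c)).
Proof.
rewrite /exp_partial (@level_csum _ _ _ _ p.+1) //; last first.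
  apply: summableMl => q r qr; rewrite level_cin; apply/qpi_eq0.
  (* The second factor is [0 ^+ 0 = 1], supplied to match a lemma about products of two powers. *)
  rewrite -[partial R ^+ r]mulr1 -(expr0 0); apply: ideal_pow_expM.
  - by apply: sub_ideal_gen; left.
  - exact: ideal_gen0.
  - by rewrite addn0.
rewrite /Texp; apply: eq_bigr => r _; rewrite /cscale rmorphM /= level_csc level_cin.
rewrite /dlin rmorph0 mul0r rmorph0 addr0 -[qpi _ (csc _ * _) ^+ r]rmorphXn /=.
rewrite exprMn_comm; last first.
  by rewrite /GRing.comm csc_central.
rewrite -(rmorphXn csc) -(rmorphXn (@cC R)) [qpi _ (_ * _)]rmorphM /= qpi_csc mulrA -cscM.
by rewrite -(rmorphM (@cC R)) [c ^+ r * _]mulrC.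
Qed.

Lemma csc_hexp p a :
  csc (hexp a 0) = Texp p.+1 (qpi (ideal_pow (@dop_J R) p) (dlin a 0)).
Proof.
rewrite (csc_mod_hbar2 _ (dquot_hbar2_eq0 p)).
have [w ->] := Ch1_trunc p.+1 (red2 (hexp a 0)).
rewrite rmorphD [X in _ + X]cscM -[csc (hbar1 ^+ _)]qpi_csc.
rewrite (_ : qpi _ (csc (hbar1 ^+ _)) = 0) ?mul0r ?addr0; last first.
  apply/qpi_eq0; rewrite rmorphXn -[_ ^+ _]mulr1 -(expr0 0).
  apply: ideal_pow_expM; last by rewrite addn0.
  - by apply: sub_ideal_gen; right.
  - exact: ideal_gen0.
rewrite rmorph_sum; apply: eq_bigr => r _.
rewrite /dlin !rmorph0 mul0r add0r qpi_csc -cscX -cscM; congr csc.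
rewrite exprMn mulrA -(rmorphXn (@cC R)) -(rmorphM (@cC R)); congr (cC _ * _).
by rewrite /= expr0 divr1 mulr1 mulrC.
Qed.

Lemma level_expd p a c : level p (expd a c : Dhat) = Texp p.+1 (qpi _ (dlin a c)).
Proof.
rewrite expd.unlock levelM level_csc level_exp_partial csc_hexp -Texp_dlinD.
by rewrite addr0 add0r.
Qed.

Lemma expdD a c a' c' : expd a c * expd a' c' = expd (a + a') (c + c') :> Dhat.
Proof.
apply: level_inj => p.
rewrite levelM !level_expd.
exact/esym/Texp_dlinD.
Qed.

Lemma expd0 : expd 0 0 = 1 :> Dhat.
Proof.
apply: level_inj => p; rewrite rmorph1 level_expd.
by rewrite /dlin !rmorph0 mul0r mul0r rmorph0 addr0 rmorph0 Texp0.
Qed.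

Lemma exp_partialE c : exp_partial c = expd 0 c :> Dhat.
Proof. by apply: level_inj => p; rewrite level_expd level_exp_partial. Qed.

Lemma hexpE a : csc (hexp a 0) = expd a 0 :> Dhat.
Proof. by apply: level_inj => p; rewrite level_expd level_csc csc_hexp. Qed.

End ExpPartial.

Lemma next_ordS N (i j : 'I_N) : Defs.next N i j = (j == ordS i).
Proof. by rewrite -val_eqE /Defs.next /= modn_small. Qed.

(* the exponent of [Q] in the entry [(b, b)] of the image of [D^k] *)
Definition Qexp (n : nat) (k : int) (b : nat) : int := k * (n%:Z - b.+1%:Z).

(** The entry [(b, b)] of the image of [D^k], with [b] counted from 0; the [exp hbar_1] part of the
    power of [Q] is merged with [exp (k n partial)]. *)
HB.lock Definition dexp (R : realType) (m n : nat) (ko k : int) (b : nat) : dop_hat R :=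
  csc (cC (omega_n R m n ko ^ Qexp n k b)) * expd (Qexp n k b)%:~R (k%:~R * n%:R).

(** * The images of the powers of [D] and of [Z], [Z^-1] *)

Section UpsValues.
Variables (R : realType) (m n : nat) (ko : int).
Hypotheses (m_gt0 : (0 < m)%N) (n_gt0 : (0 < n)%N).
Local Notation Dhat := (dop_hat R).
Local Notation diffop := (diffop R m n ko).
Local Notation N := (m * n)%N.
Local Notation dexp := (dexp R m n ko).
Local Notation Qexp := (Qexp n).

Lemma omega_n_neq0 : omega_n R m n ko != 0.
Proof. by rewrite expf_neq0 // omega_neq0. Qed.

Lemma QexpD k l b : Qexp (k + l) b = Qexp k b + Qexp l b.
Proof. exact: mulrDl. Qed.

Lemma dexpD k l b : dexp k b * dexp l b = dexp (k + l) b.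
Proof.
rewrite dexp.unlock cscMACA -(rmorphM (@cC R)) expdD -expfzDr ?omega_n_neq0 //.
by rewrite QexpD !intrD mulrDl.
Qed.

Lemma dexp0 b : dexp 0 b = 1.
Proof. by rewrite dexp.unlock /Qexp !mul0r expr0z cC1 csc1 mul1r expd0. Qed.

Definition Dmx (k : int) : 'M[Dhat]_n := \matrix_(i, j) if i == j then dexp k i else 0.

Lemma DmxD k l : Dmx k * Dmx l = Dmx (k + l).
Proof.
apply/matrixP => i j; rewrite !mxE (bigD1 i) //= !mxE eqxx big1 ?addr0; last first.
  by move=> s si; rewrite !mxE eq_sym (negPf si) mul0r.
by case: eqP => [->|_]; rewrite ?dexpD ?mulr0.
Qed.

Lemma Dmx0 : Dmx 0 = 1.
Proof. by apply/matrixP => i j; rewrite !mxE dexp0; case: eqP. Qed.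

Lemma csc_Qpow z :
  csc (Qpow R m n ko z) = csc (cC (omega_n R m n ko ^ z)) * expd z%:~R 0 :> Dhat.
Proof. by rewrite cscM hexpE. Qed.

Lemma csc_Qexpr j : csc (Q R m n ko ^+ j) = csc (Qpow R m n ko j%:Z) :> Dhat.
Proof.
elim: j => [|j IH]; first by rewrite csc_Qpow !expr0z cC1 csc1 mul1r expd0.
rewrite exprS cscM IH !csc_Qpow cscMACA -(rmorphM (@cC R)) -expfzDr ?omega_n_neq0 //.
by rewrite expdD addr0 intS intrD.
Qed.

Lemma Upsilon_DE : Upsilon_D R m n ko = Dmx 1.
Proof.
apply/matrixP => i j; rewrite /Upsilon_D summxE mxE.
rewrite (eq_bigr (fun a => if (a == i.+1) && (i == j)
  then Q R m n ko ^+ (n - a) *! exp_partial n%:R else 0)); last first.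
  move=> a _; rewrite mxE -val_eqE /=; case: (eqVneq a i.+1) => // ->.
  by rewrite eqSS eq_sym.
case: eqP => ij; last by rewrite big1 // => a _; rewrite andbF.
rewrite (bigD1_seq i.+1) ?iota_uniq ?mem_index_iota //= ?eqxx; last by rewrite ltnS ltn_ord.
rewrite big1 ?addr0; last by move=> a /negPf ->.
rewrite /cscale csc_Qexpr csc_Qpow exp_partialE -mulrA expdD addr0 add0r.
by rewrite dexp.unlock /Qexp !mul1r subzn.
Qed.

(** [u] stands where the cyclic successor wraps around, [v] at the other places; the inverse is the
    transposed pattern with inverted entries. *)
Definition Zmx (u v : Dhat) : 'M[Dhat]_n :=
  \matrix_(i, j) if j == ordS i then (if i.+1 == n then u else v) else 0.

Lemma Upsilon_ZE : Upsilon_Z R n = Zmx (cin _ (xpow R 1)) 1.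
Proof.
apply/matrixP => i j; rewrite /Upsilon_Z mxE summxE !mxE.
rewrite -next_ordS /Defs.next; case: (eqVneq i.+1 n) => [iN|iN].
  rewrite big_nat_cond big1 ?add0r.
    by rewrite iN modnn modn_small //; case: (val j).
  move=> a /andP[/andP[_ an] _]; rewrite mxE; case: eqP => // ia.
  by move: an; rewrite -ia iN ltnn.
have i1n : (i.+1 < n)%N by rewrite ltn_neqAle iN ltn_ord.
rewrite addr0 !modn_small //.
case: (eqVneq (j : nat) i.+1) => ji; last first.
  rewrite big1 // => a _; rewrite mxE; case: eqP => //= <-.
  by rewrite eqSS (negPf ji).
rewrite (bigD1_seq i.+1) ?iota_uniq ?mem_index_iota //=.
rewrite mxE ji !eqxx big1 ?addr0 // => a ai.
by rewrite mxE [i.+1 == a]eq_sym (negPf ai).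
Qed.

Definition Zmx_inv (u v : Dhat) : 'M[Dhat]_n :=
  \matrix_(i, j) if i == ordS j then (if j.+1 == n then u else v) else 0.

Lemma Zmx_invK (u u' v v' : Dhat) : u * u' = 1 -> v * v' = 1 ->
  Zmx u v * Zmx_inv u' v' = 1.
Proof.
move=> uu vv; apply/matrixP => i j; rewrite !mxE (bigD1 (ordS i)) //= !mxE eqxx.
rewrite big1 ?addr0; last by move=> s /negPf si; rewrite !mxE si mul0r.
rewrite (inj_eq (@ordS_inj n)); case: (eqVneq i j) => [->|_]; last exact: mulr0.
by case: ifP.
Qed.

Variable ups : {rmorphism diffop -> 'M[Dhat]_n}.
Hypothesis ups_csc : forall s, ups (csc s) = (csc s)%:M.
Hypothesis ups_D : ups (Dpow R m n ko 1) = Upsilon_D R m n ko.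
Hypothesis ups_Z : ups (Zpow R m n ko 1) = Upsilon_Z R n.

Lemma ups_Dpow k : ups (Dpow R m n ko k) = Dmx k.
Proof.
have Dmxn j : Dmx j%:Z = Dmx 1 ^+ j.
  by elim: j => [|j IH]; rewrite ?Dmx0 // exprS -IH DmxD -intS.
have upsD : ups (pgen (@diffop_rel R m n ko) gD) = Dmx 1.
  by rewrite -Upsilon_DE -ups_D.
case: k => j; first by rewrite rmorphXn /= upsD Dmxn.
have upsDi : ups (pgen (@diffop_rel R m n ko) gDi) = Dmx (-1).
  have DDi : pgen (@diffop_rel R m n ko) gDi * pgen (@diffop_rel R m n ko) gD = 1.
    apply/eqP; rewrite -subr_eq0; apply/eqP.
    have := pres_rel (@diff_DiD R m n ko).
    by rewrite rmorphB rmorphM rmorph1.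
  (* The image of [D^-1] is a left inverse of [Dmx 1], so it equals the right inverse [Dmx (-1)]. *)
  rewrite -[LHS]mulr1 -Dmx0 -(subrr 1) -DmxD mulrA -upsD -rmorphM DDi.
  by rewrite rmorph1 mul1r.
rewrite rmorphXn /= upsDi NegzE.
elim: (j.+1) => [|i IH]; first by rewrite Dmx0.
by rewrite exprS IH DmxD intS opprD.
Qed.

Lemma ups_Zpow1 : ups (Zpow R m n ko 1) = Zmx (cin _ (xpow R 1)) 1.
Proof. by rewrite ups_Z Upsilon_ZE. Qed.

(** A left inverse, from the relation [Z^-1 Z = 1], coincides with the explicit right inverse. *)
Lemma ups_ZpowN1 : ups (Zpow R m n ko (-1)) = Zmx_inv (cin _ (xpow R (-1))) 1.
Proof.
have ZiZ : Zpow R m n ko (-1) * Zpow R m n ko 1 = 1.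
  apply/eqP; rewrite -subr_eq0; apply/eqP.
  have := pres_rel (@diff_ZiZ R m n ko).
  by rewrite rmorphB rmorphM rmorph1.
have xxi : xpow R 1 * xpow R (-1) = 1.
  apply/eqP; rewrite -subr_eq0; apply/eqP.
  have := pres_rel (@dop_xxi R).
  by rewrite rmorphB rmorphM rmorph1.
have ZK : Zmx (cin _ (xpow R 1)) 1 * Zmx_inv (cin _ (xpow R (-1))) 1 = 1.
  by apply: Zmx_invK; rewrite ?mulr1 // -rmorphM xxi rmorph1.
rewrite -[LHS]mulr1 -ZK mulrA -ups_Zpow1 -rmorphM ZiZ rmorph1 mul1r.
by [].
Qed.

Lemma ups_scale s u i j : ups (csc s * u) i j = csc s * ups u i j.
Proof.
rewrite rmorphM ups_csc /= -[_ * _]/(_ *m _) mul_scalar_mx mxE.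
by [].
Qed.

End UpsValues.

(** * Matching powers of [omega] and shifts of [partial] *)

Section Entries.
Variables (R : realType) (m n : nat) (ko : int).
Hypotheses (m_gt0 : (0 < m)%N) (n_gt0 : (0 < n)%N).
Local Notation C := (R[i]%C).
Local Notation omega := (omega R m n ko).
Local Notation N := (m * n)%N.
Local Notation dexp := (dexp R m n ko).
Local Notation dquot p := (quot (ideal_pow (@dop_J R) p)).

(* the truncation of [omega^(- k s) exp (k n (partial + (1 - s / N) hbar_1))] *)
Definition dval (p : nat) (k : int) (s : nat) : dquot p :=
  csc (cC (omega ^ (- (k * s%:Z))))
  * \sum_(r < p.+1) csc (cC ((k%:~R * n%:R) ^+ r / (r`!)%:R)) * qpi _ (dshift R N s r).

(** As [Q = q_1^m], the factors [q_1^((m - i) k)] and [Q^(k (n - b - 1))] make up [q_1^e] with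
    [e = N k - k (m b + i)]; in its root of unity part [omega^e] the term [N k] drops out. *)
Lemma omega_shift (k : int) (b i : nat) :
  omega ^ ((m%:Z - i%:Z) * k) * omega_n R m n ko ^ Qexp n k b
  = omega ^ (- (k * (m * b + i)%N%:Z)).
Proof.
have w0 := omega_neq0 R m n ko.
rewrite /omega_n exprnP exprz_exp -expfzDr //.
rewrite (_ : _ + _ = - (k * (m * b + i)%N%:Z) + N%:Z * k); last first.
  by rewrite /Qexp; lia.
by rewrite expfzDr // -[omega ^ (N%:Z * k)]exprz_exp -exprnP omega_mn // exp1rz mulr1.
Qed.

(** The same exponent [e] in [exp (e hbar_1 / m)]: here [e / m = k n (1 - (m b + i) / N)], which is
    [k n] times the shift at index [m b + i]. *)
Lemma dlin_dshift (k : int) (b i r : nat) :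
  dlin (((m%:Z - i%:Z) * k)%:~R / m%:R + (Qexp n k b)%:~R) (k%:~R * n%:R) ^+ r
  = csc (cC ((k%:~R * n%:R) ^+ r)) * dshift R N (m * b + i) r.
Proof.
rewrite /dlin /dshift.
have m0 : m%:R != 0 :> C by rewrite pnatr_eq0 -lt0n.
have n0 : n%:R != 0 :> C by rewrite pnatr_eq0 -lt0n.
set c := k%:~R * n%:R.
rewrite (_ : _ + (Qexp n k b)%:~R = c * (1 - (m * b + i)%:R / N%:R)); last first.
  rewrite /c /Qexp !rmorphM !rmorphB /= -!pmulrn -addn1 !natrD !natrM.
  by field; rewrite m0 n0.
have fac (e : C) : csc (cC c) * partial R + csc (cC (c * e) * hbar1)
    = csc (cC c) * (partial R + csc (cC e * hbar1)).
  by rewrite mulrDr -cscM mulrA -(rmorphM (@cC R)).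
rewrite fac exprMn_comm; last by rewrite /GRing.comm csc_central.
by rewrite -cscX -(rmorphXn (@cC R)).
Qed.

Lemma level_dexp p (k : int) (b i : nat) :
  level p (csc (q1pow R m n ko ((m%:Z - i%:Z) * k)) * dexp k b)
  = dval p k (m * b + i).
Proof.
rewrite dexp.unlock /q1pow cscM hexpE cscMACA expdD add0r -(rmorphM (@cC R)).
rewrite omega_shift levelM level_csc level_expd /dval; congr (_ * _).
apply: eq_bigr => r _; rewrite -rmorphXn /= dlin_dshift rmorphM /= qpi_csc mulrA.
by rewrite -cscM -(rmorphM (@cC R)) [_ ^+ r / _]mulrC.
Qed.

End Entries.

(** * Comparison of matrix entries *)

Section Digits.
Variables m n : nat.
Hypothesis m_gt0 : (0 < m)%N.
Local Notation N := (m * n)%N.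

Fact lo_subproof (I : 'I_N) : (I %% m < m)%N.
Proof. by rewrite ltn_mod. Qed.
Fact hi_subproof (I : 'I_N) : (I %/ m < n)%N.
Proof. by rewrite ltn_divLR // [ltnRHS]mulnC ltn_ord. Qed.
Definition lo (I : 'I_N) : 'I_m := Ordinal (lo_subproof I).
Definition hi (I : 'I_N) : 'I_n := Ordinal (hi_subproof I).

Lemma hi_lo (I : 'I_N) : I = (m * hi I + lo I)%N :> nat.
Proof. by rewrite [X in (X + _)%N]mulnC -divn_eq. Qed.

Lemma hi_loP (I : 'I_N) (b a : nat) : (a < m)%N ->
  ((I : nat) == m * b + a)%N = ((lo I : nat) == a) && ((hi I : nat) == b).
Proof.
move=> am; apply/eqP/andP => [e|[/eqP <- /eqP <-]]; last exact: hi_lo.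
by rewrite /= e [(m * b)%N]mulnC divnMDl // divn_small // addn0 modnMDl modn_small.
Qed.

Lemma lo_hi_inj (I J : 'I_N) : (I == J) = (lo I == lo J) && (hi I == hi J).
Proof. by rewrite -!val_eqE /= [in LHS](hi_lo J) hi_loP ?ltn_ord. Qed.

Lemma lo_ordS (I : 'I_N) : lo (ordS I) = ordS (lo I).
Proof.
by apply: val_inj; rewrite /= modn_dvdm ?dvdn_mulr // -[in RHS]addn1 modnDml addn1.
Qed.

(** A carry occurs exactly when the low digit wraps to 0; the cyclic successor of the high digit
    covers the last index. *)
Lemma ordS_digits (I : 'I_N) :
  hi (ordS I) = if ordS (lo I) == 0%N :> nat then ordS (hi I) else hi I.
Proof.
apply: val_inj; rewrite -[RHS]/(val (if _ then _ else _)).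
have ln := ltn_ord (lo I); have hn := ltn_ord (hi I).
have e := hi_lo I; have IN := ltn_ord I.
have [lm|lm] := eqVneq ((lo I).+1) m.
  rewrite {2}/ordS /= -[(I %% m).+1]/((lo I).+1) lm modnn /= -[(I %/ m)%N]/(hi I : nat).
  have -> : (I : nat).+1 = ((hi I).+1 * m)%N by rewrite mulSn [(hi I * m)%N]mulnC; lia.
  suff h d : ((d * m %% (m * n)) %/ m = d %% n)%N by exact: h.
  by rewrite [(m * n)%N]mulnC -muln_modl mulnK.
have lm' : ((lo I).+1 < m)%N by rewrite ltn_neqAle lm.
have -> : (ordS (lo I) == 0%N :> nat) = false by rewrite /= modn_small.
have S : (I : nat).+1 = (hi I * m + (lo I).+1)%N by rewrite [(hi I * m)%N]mulnC; lia.
have SN : (I.+1 < N)%N.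
  rewrite S; apply: (@leq_trans ((hi I).+1 * m)); first by rewrite mulSn; lia.
  by rewrite [leqLHS]mulnC leq_mul2l hn orbT.
by rewrite /= modn_small // S divnMDl // [((lo I).+1 %/ m)%N]divn_small // addn0.
Qed.

Lemma ordS_eq_digits (I J : 'I_N) :
  (J == ordS I) = (lo J == ordS (lo I))
    && (hi J == if lo J == 0%N :> nat then ordS (hi I) else hi I).
Proof.
rewrite lo_hi_inj lo_ordS ordS_digits; case: eqP => [->|] //.
Qed.

(* the low digit of [I + 1], taken in [1, m], when [i] is its residue modulo [m] *)
Definition top_digit (i : nat) : nat := if i == 0%N then m else i.

(** With a low digit in [[1, m]] there is no carry: [I + 1] stays in the block [hi I], the form in
    which [level_dexp] produces the shift. *)
Lemma succ_digits (I : 'I_N) (i : 'I_m) : i = ordS (lo I) ->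
  (I : nat).+1 = (m * hi I + top_digit i)%N.
Proof.
move=> ->; rewrite /top_digit; have e := hi_lo I; have ln := ltn_ord (lo I).
have [lm|lm] := eqVneq ((lo I).+1) m.
  by rewrite /= -[(I %% m).+1]/((lo I).+1) lm modnn /= -[(I %/ m)%N]/(hi I : nat); lia.
have lm' : ((lo I).+1 < m)%N by rewrite ltn_neqAle lm.
rewrite /ordS /= modn_small //= -[(I %% m)%N]/(lo I : nat) -[(I %/ m)%N]/(hi I : nat).
by lia.
Qed.

(** The factor [x] of [vartheta] sits at the last index; here that place is identified with the wrap
    of [Z] at vertex 0. *)
Lemma succ_max_digits (I : 'I_N) (i : 'I_m) : i = ordS (lo I) ->
  (I.+1 == N) = (i == 0%N :> nat) && ((hi I).+1 == n).
Proof.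
move=> iI; rewrite (succ_digits iI) /top_digit; have hn := ltn_ord (hi I).
have ii := ltn_ord i; case: (eqVneq (i : nat) 0%N) => [_|i0] /=.
  by rewrite addnC -mulnS eqn_mul2l (gtn_eqF m_gt0).
apply/negP => /eqP e; have := leq_mul (leqnn m) hn.
by rewrite -[(m * n)%N]e mulnS addnC leq_add2l leqNgt ii.
Qed.

Lemma eq_mod_lo (I : 'I_N) (i : 'I_m) : (I == i %[mod m])%N = (i == lo I).
Proof. by rewrite -val_eqE /= [(i %% m)%N]modn_small ?ltn_ord // eq_sym. Qed.

End Digits.

(** * Matrix entries of [theta] and [vartheta] *)

Section MatrixUnits.
Variable R : realType.

(** Counted from 0, the units [E_{d,1}] of vertex 0 and [E_{i,i+1}] of vertex [i] both sit at
    [(a, ordS a)] with [ordS a = i]. *)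
Lemma Emx_succ (A : calgType (Ch R)) d (u v : A) (i a b : 'I_d) :
  (if i == 0%N :> nat then Emx d d 1 u else Emx d i i.+1 v) a b
  = if (b == i) && (i == ordS a) then (if i == 0%N :> nat then u else v) else 0.
Proof.
have ad := ltn_ord a; rewrite -!val_eqE /=; case: (eqVneq (i : nat) 0%N) => [i0|i0].
  rewrite mxE eqSS i0 andbC eq_sym; congr (if _ && _ then _ else _).
  case: (eqVneq a.+1 d) => [->|ne]; first by rewrite modnn.
  by rewrite modn_small // ltn_neqAle ne.
rewrite mxE eqSS andbC; congr (if _ && _ then _ else _).
case: (eqVneq a.+1 d) => [ad1|ne]; last by rewrite modn_small 1?eq_sym // ltn_neqAle ne.
by rewrite ad1 modnn (negPf i0) eq_sym (ltn_eqF (ltn_ord i)).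
Qed.

Lemma Emx_tr (A : calgType (Ch R)) d (u : A) s t (a b : 'I_d) :
  Emx d s t u a b = Emx d t s u b a.
Proof. by rewrite !mxE andbC. Qed.

(** The two terms are kept as a difference because for [d = 1] both conditions hold at the same
    entry. *)
Lemma Emx_diag (A : calgType (Ch R)) d (u v w : A) (i a b : 'I_d) :
  (if i == 0%N :> nat then Emx d d d u else Emx d i i v) a b
    - Emx d i.+1 i.+1 w a b
  = if a == b then (if i == ordS a then (if i == 0%N :> nat then u else v) else 0)
                   - (if i == a then w else 0) else 0.
Proof.
have ad := ltn_ord a; have id := ltn_ord i; rewrite -!val_eqE /=.
have -> : Emx d i.+1 i.+1 w a b = if (a == b :> nat) && (i == a :> nat) then w else 0.
  by rewrite mxE !eqSS; congr (if _ then _ else _); lia.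
have -> : (if i == 0%N :> nat then Emx d d d u else Emx d i i v) a b
   = if (a == b :> nat) && (i == a.+1 %% d :> nat)%N
     then (if i == 0%N :> nat then u else v) else 0.
  have bd := ltn_ord b; case: (eqVneq (i : nat) 0%N) => i0; rewrite mxE.
    congr (if _ then _ else _); case: (eqVneq a.+1 d) => [e|ne]; last first.
      by rewrite modn_small ?i0 ?andbF // ltn_neqAle ne.
    by rewrite e modnn i0 andbT; lia.
  congr (if _ then _ else _); case: (eqVneq a.+1 d) => [e|ne]; last first.
    by rewrite modn_small ?ltn_neqAle ?ne //; lia.
  by rewrite e modnn (negPf i0) andbF; lia.
by case: eqP => //= _; rewrite subrr.
Qed.

End MatrixUnits.

Section ThetaEntries.
Variables (R : realType) (m n : nat) (ko : int).
Hypotheses (m_gt0 : (0 < m)%N) (n_gt0 : (0 < n)%N).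
Local Notation Dhat := (dop_hat R).
Local Notation N := (m * n)%N.
Local Notation Dpow := (Dpow R m n ko).
Local Notation Zpow := (Zpow R m n ko).
Local Notation qDpow := (qDpow R m n ko).
Local Notation lo := (lo m_gt0).
Local Notation hi := (hi m_gt0).

Lemma mflatE (X : 'M['M[Dhat]_n]_m) (I J : 'I_N) :
  mflat X I J = X (lo I) (lo J) (hi I) (hi J).
Proof.
have pos (K : 'I_N) (a : 'I_m) (k : 'I_n) :
    (K.+1 == m * k + a.+1)%N = (lo K == a) && (hi K == k).
  by rewrite addnS eqSS (hi_loP m_gt0).
pose T (b : bool) (x : Dhat) := if b then x else 0.
have -> : mflat X I J = \sum_(a < m) \sum_(b < m) \sum_(k < n) \sum_(l < n)
    T (((lo I == a) && (hi I == k)) && ((lo J == b) && (hi J == l))) (X a b k l).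
  rewrite /mflat summxE; apply: eq_bigr => a _; rewrite summxE; apply: eq_bigr => b _.
  rewrite summxE; apply: eq_bigr => k _; rewrite summxE; apply: eq_bigr => l _.
  by rewrite mxE !pos.
rewrite (bigD1 (lo I)) //= [X in _ + X]big1 ?addr0; last first.
  move=> a aI; rewrite !big1 // => b _; rewrite big1 // => k _; rewrite big1 // => l _.
  by rewrite [lo I == a]eq_sym (negPf aI).
rewrite (bigD1 (lo J)) //= [X in _ + X]big1 ?addr0; last first.
  move=> b bJ; rewrite big1 // => k _; rewrite big1 // => l _.
  by rewrite [lo J == b]eq_sym (negPf bJ) andbF.
rewrite (bigD1 (hi I)) //= [X in _ + X]big1 ?addr0; last first.
  move=> k kI; rewrite big1 // => l _.
  by rewrite [hi I == k]eq_sym (negPf kI) andbF.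
rewrite (bigD1 (hi J)) //= [X in _ + X]big1 ?addr0; last first.
  by move=> l lJ; rewrite [hi J == l]eq_sym (negPf lJ) !andbF.
by rewrite !eqxx.
Qed.

Lemma theta_e_entry (i : 'I_m) k (a b : 'I_m) :
  (theta_val R n ko (Ue i k)).1 a b = if (b == i) && (i == ordS a)
    then (if i == 0%N :> nat then Dpow k * Zpow 1 else qDpow (m%:Z - i%:Z) k) else 0.
Proof.
rewrite -(Emx_succ (Dpow k * Zpow 1)) /=.
by case: ifP.
Qed.

Lemma theta_f_entry (i : 'I_m) k (a b : 'I_m) :
  (theta_val R n ko (Uf i k)).1 a b = if (a == i) && (i == ordS b)
    then (if i == 0%N :> nat then Zpow (-1) * Dpow k else qDpow (m%:Z - i%:Z) k) else 0.
Proof.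
rewrite -(Emx_succ (Zpow (-1) * Dpow k)) /=.
by case: ifP => _; rewrite Emx_tr.
Qed.

Lemma theta_h_entry (i : 'I_m) k (a b : 'I_m) :
  (theta_val R n ko (Uh i k)).1 a b = if a == b then
    (if i == ordS a then (if i == 0%N :> nat then Dpow k else qDpow (m%:Z - i%:Z) k) else 0)
    - (if i == a then qDpow (m%:Z - i%:Z) k else 0) else 0.
Proof.
rewrite -Emx_diag /=; case: eqP => [i0|_] /=; rewrite !mxE /=.
  by rewrite i0 subr0 addr0.
by [].
Qed.

End ThetaEntries.

Section VarthetaEntries.
Variables (R : realType) (N : nat).
Local Notation dshift := (dshift R N).

Lemma dshift0 r : dshift 0 r = (partial R + csc hbar1) ^+ r.
Proof. by rewrite /Defs.dshift mul0r subr0 cC1 mul1r. Qed.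

Lemma dshiftN r : (0 < N)%N -> dshift N r = partial R ^+ r.
Proof.
move=> N0; rewrite /Defs.dshift divff ?pnatr_eq0 -?lt0n // subrr rmorph0 mul0r.
by rewrite csc0 addr0.
Qed.

Lemma ordS_eq0 (a : 'I_N) : (ordS a == 0%N :> nat) = (a.+1 == N).
Proof.
have aN := ltn_ord a; rewrite /=; case: (eqVneq a.+1 N) => [->|ne]; first by rewrite modnn.
by rewrite modn_small // ltn_neqAle ne.
Qed.

Lemma ordS_small (a : 'I_N) : a.+1 != N -> ordS a = a.+1 :> nat.
Proof. by have aN := ltn_ord a => ne; rewrite /= modn_small // ltn_neqAle ne. Qed.

(** Shifting by [I.+1], which lies in [[1, N]], absorbs the special value at vertex 0, as
    [dshift N r] is a plain power of [partial]; only the factor [x] is left over. *)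
Lemma vartheta_xp_entry (i I J : 'I_N) r :
  (vartheta_val R (Yx true i r)).1 I J = if (J == i) && (i == ordS I)
    then dshift I.+1 r * (if I.+1 == N then xpow R 1 else 1) else 0.
Proof.
transitivity (if (J == i) && (i == ordS I) then
    (if i == 0%N :> nat then partial R ^+ r * xpow R 1 else dshift i r) else 0).
  by rewrite -Emx_succ /=; case: ifP.
case: eqP => //= _; case: eqP => // ->; rewrite ordS_eq0.
case: eqP => [->|/eqP/ordS_small ->]; last by rewrite mulr1.
by rewrite dshiftN // (leq_ltn_trans _ (ltn_ord I)).
Qed.

Lemma vartheta_xm_entry (i I J : 'I_N) r :
  (vartheta_val R (Yx false i r)).1 I J = if (I == i) && (i == ordS J)
    then (if J.+1 == N then xpow R (-1) else 1) * dshift J.+1 r else 0.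
Proof.
transitivity (if (I == i) && (i == ordS J) then
    (if i == 0%N :> nat then xpow R (-1) * partial R ^+ r else dshift i r) else 0).
  by rewrite -Emx_succ /=; case: ifP => _; rewrite Emx_tr.
case: eqP => //= _; case: eqP => // ->; rewrite ordS_eq0.
case: eqP => [->|/eqP/ordS_small ->]; last by rewrite mul1r.
by rewrite dshiftN // (leq_ltn_trans _ (ltn_ord J)).
Qed.

(** At vertex 0 the two terms use both representatives: [N] gives [partial], and 0 gives
    [partial + hbar_1]. *)
Lemma vartheta_xi_entry (i I J : 'I_N) r :
  (vartheta_val R (Yxi i r)).1 I J = if I == J
    then (if i == ordS I then dshift I.+1 r else 0) - (if i == I then dshift I r else 0)
    else 0.
Proof.
transitivity (if I == J then
    (if i == ordS I then (if i == 0%N :> nat then partial R ^+ r else dshift i r) else 0)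
    - (if i == I then dshift i r else 0) else 0).
  rewrite -Emx_diag /=; case: eqP => [i0|_] /=; rewrite !mxE /=; last by [].
  by rewrite i0 dshift0; case: r => [|r]; rewrite mxE addr0.
case: ifP => // _; congr (_ - _); last by case: eqP => [->|].
case: eqP => // ->; rewrite ordS_eq0.
case: eqP => [->|/eqP/ordS_small ->] //.
by rewrite dshiftN // (leq_ltn_trans _ (ltn_ord I)).
Qed.

End VarthetaEntries.

(** * Equality of the entries at each level *)

Section Compare.
Variables (R : realType) (m n : nat) (ko : int).
Hypotheses (m_gt0 : (0 < m)%N) (n_gt0 : (0 < n)%N).
Local Notation dop := (dop R).
Local Notation Dhat := (dop_hat R).
Local Notation diffop := (diffop R m n ko).
Local Notation omega := (omega R m n ko).
Local Notation N := (m * n)%N.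
Local Notation dexp := (dexp R m n ko).
Local Notation Dpow := (Dpow R m n ko).
Local Notation Zpow := (Zpow R m n ko).
Local Notation qDpow := (qDpow R m n ko).
Local Notation dval := (dval R m n ko).
Local Notation dquot p := (quot (ideal_pow (@dop_J R) p)).
Local Notation lo := (lo m_gt0).
Local Notation hi := (hi m_gt0).

(** The shape of [V_Phi_val] at one matrix entry, with [F i' r] the entry of the image of the
    Yangian generator. *)
Definition dsum (p : nat) (k : int) (i : 'I_m) (F : 'I_N -> nat -> dop) : dquot p :=
  \sum_(i' < N | i' == i %[mod m]) csc (cC (omega ^ (- (k * i'%:Z))))
  * \sum_(r < p.+1) csc (cC ((k%:~R * n%:R) ^+ r / (r`!)%:R)) * qpi _ (F i' r).

Lemma dsumB p k i F G :
  dsum p k i (fun i' r => F i' r - G i' r) = dsum p k i F - dsum p k i G.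
Proof.
rewrite -sumrB; apply: eq_bigr => i' _; rewrite -mulrBr -sumrB; congr (_ * _).
by apply: eq_bigr => r _; rewrite rmorphB mulrBr.
Qed.

Lemma dsum_eq0 p k i F : (forall i' r, F i' r = 0) -> dsum p k i F = 0.
Proof.
move=> F0; rewrite /dsum big1 // => i' _; rewrite big1 ?mulr0 // => r _.
by rewrite F0 rmorph0 mulr0.
Qed.

(** Lets the index 0 be replaced by [N], the representative used in the shift. *)
Lemma omega_mod (k : int) (s t : nat) : (s = t %[mod N])%N ->
  omega ^ (- (k * s%:Z)) = omega ^ (- (k * t%:Z)).
Proof.
have red u : omega ^ (- (k * u%:Z)) = omega ^ (- (k * (u %% N)%N%:Z)).
  rewrite {1}(divn_eq u N) PoszD PoszM mulrDr opprD expfzDr ?omega_neq0 //.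
  rewrite (_ : - (k * ((u %/ N)%N%:Z * N%:Z)) = N%:Z * (- k * (u %/ N)%N%:Z)); last by ring.
  by rewrite -exprz_exp -exprnP omega_mn // exp1rz mul1r.
by move=> st; rewrite red st -red.
Qed.

(** Only one [i'] contributes to a given entry; [s] is the representative of it used in the shift,
    and [u], [v] hold the power of [x] on the left or right. *)
Lemma dsum_single p k (i : 'I_m) (I0 : 'I_N) (s : nat) (u v : dop) F :
  (forall i' r, F i' r = if i' == I0 then u * dshift R N s r * v else 0) ->
  (s = I0 %[mod N])%N ->
  dsum p k i F = if i == lo I0 then qpi _ u * dval p k s * qpi _ v else 0.
Proof.
move=> FE sI0; rewrite /dsum big_mkcond (bigD1 I0) //= [X in _ + X]big1 ?addr0; last first.
  move=> i' /negPf ne; rewrite big1 ?mulr0 ?if_same // => r _.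
  by rewrite FE ne rmorph0 mulr0.
rewrite (eq_mod_lo m_gt0); case: (i == lo I0) => //.
rewrite /dval -(omega_mod k sI0) !mulrA -csc_central -!mulrA; congr (_ * _).
rewrite mulr_suml mulr_sumr; apply: eq_bigr => r _; rewrite FE eqxx.
rewrite (rmorphM (qpi _) (u * _)) (rmorphM (qpi _) u) /= !mulrA; congr (_ * _ * _).
exact: csc_central.
Qed.

(** The plain [D] of vertex 0 is [q_1^(m - i) D] with [i = m]. *)
Lemma level_dexp0 p k b : level p (dexp k b) = dval p k (m * b + m).
Proof.
rewrite -(level_dexp R ko m_gt0 n_gt0) subrr mul0r /q1pow expr0z cC1 mul1r mul0r.
by rewrite levelM level_csc csc_hexp /dlin !rmorph0 !mul0r csc0 addr0 rmorph0 Texp0 // mul1r.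
Qed.

Variable ups : {rmorphism diffop -> 'M[Dhat]_n}.
Hypothesis ups_csc : forall s, ups (csc s) = (csc s)%:M.
Hypothesis ups_D : ups (Dpow 1) = Upsilon_D R m n ko.
Hypothesis ups_Z : ups (Zpow 1) = Upsilon_Z R n.

Local Notation image x := (mflat (map_mx ups (theta_val R n ko x).1)).

Lemma level_ups_qDpow p k (i : nat) (b b' : 'I_n) :
  level p (ups (qDpow (m%:Z - i%:Z) k) b b')
  = if b == b' then dval p k (m * b + i) else 0.
Proof.
rewrite (ups_scale ups_csc) (ups_Dpow ups_D) mxE; case: eqP => _.
  exact: level_dexp.
by rewrite mulr0 rmorph0.
Qed.

(** Both sides live at [J = I + 1]. For [i != 0] there is no carry, and the diagonal image of [D^k]
    keeps the block; for [i = 0] the factor [Z] moves to the next block. Elsewhere either the entry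
    of [theta] is zero or the blocks do not match. *)
Lemma image_xp p (i : 'I_m) k (I J : 'I_N) :
  level p (image (Ue i k) I J)
  = dsum p k i (fun i' r => (vartheta_val R (Yx true i' r)).1 I J).
Proof.
rewrite (mflatE m_gt0) mxE theta_e_entry.
have [JI|JI] := eqVneq J (ordS I); last first.
  rewrite dsum_eq0; last first.
    move=> i' r; rewrite vartheta_xp_entry; case: eqP => //= <-.
    by rewrite (negPf JI).
  move: JI; rewrite (ordS_eq_digits m_gt0).
  case: (eqVneq (lo J) i) => [Ji|_]; last by rewrite andFb !rmorph0 mxE rmorph0.
  rewrite andTb Ji; case: (eqVneq i (ordS (lo I))) => [iI|_]; last first.
    by rewrite !rmorph0 mxE rmorph0.
  rewrite andTb; case: (eqVneq (i : nat) 0%N) => i0 hIJ; last first.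
    by rewrite level_ups_qDpow eq_sym (negPf hIJ).
  rewrite rmorphM (ups_Dpow ups_D) (ups_Zpow1 ups_Z) !mxE big1 ?rmorph0 // => s _.
  rewrite !mxE; case: eqP => [<-|_]; last by rewrite mul0r.
  by rewrite (negPf hIJ) mulr0.
rewrite (@dsum_single _ _ _ J I.+1 1 (if I.+1 == N then xpow R 1 else 1)); last 2 first.
- move=> i' r; rewrite vartheta_xp_entry mul1r JI eq_sym.
  by case: (eqVneq i' (ordS I)).
- by rewrite JI /= modn_mod.
move: (JI) => /eqP; rewrite (ordS_eq_digits m_gt0) => /andP[/eqP lJ /eqP hJ].
rewrite [i == lo J]eq_sym; case: (eqVneq (lo J) i) => [Ji|_] /=; last first.
  by rewrite !rmorph0 mxE rmorph0.
have iI : i = ordS (lo I) by rewrite -Ji.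
rewrite -iI eqxx rmorph1 mul1r (succ_max_digits iI) (succ_digits iI).
move: hJ; rewrite Ji /top_digit; case: (eqVneq (i : nat) 0%N) => i0 hJ /=; last first.
  by rewrite level_ups_qDpow hJ eqxx rmorph1 mulr1.
rewrite rmorphM (ups_Dpow ups_D) (ups_Zpow1 ups_Z) mxE.
rewrite (bigD1 (hi I)) //= big1 ?addr0; last first.
  by move=> s; rewrite mxE eq_sym => /negPf ->; rewrite mul0r.
rewrite !mxE eqxx hJ eqxx levelM level_dexp0; congr (_ * _).
by case: ifP => _; rewrite ?level_cin ?rmorph1.
Qed.

Lemma image_xm p (i : 'I_m) k (I J : 'I_N) :
  level p (image (Uf i k) I J)
  = dsum p k i (fun i' r => (vartheta_val R (Yx false i' r)).1 I J).
Proof.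
rewrite (mflatE m_gt0) mxE theta_f_entry.
have [IJ|IJ] := eqVneq I (ordS J); last first.
  rewrite dsum_eq0; last first.
    move=> i' r; rewrite vartheta_xm_entry; case: eqP => //= <-.
    by rewrite (negPf IJ).
  move: IJ; rewrite (ordS_eq_digits m_gt0).
  case: (eqVneq (lo I) i) => [Ii|_]; last by rewrite andFb !rmorph0 mxE rmorph0.
  rewrite andTb Ii; case: (eqVneq i (ordS (lo J))) => [iJ|_]; last first.
    by rewrite !rmorph0 mxE rmorph0.
  rewrite andTb; case: (eqVneq (i : nat) 0%N) => i0 hIJ; last first.
    by rewrite level_ups_qDpow (negPf hIJ).
  rewrite rmorphM (ups_Dpow ups_D) (ups_ZpowN1 ups_Z) !mxE big1 ?rmorph0 // => s _.
  rewrite !mxE; case: (eqVneq s (hi J)) => [->|_]; last by rewrite mulr0.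
  by rewrite (negPf hIJ) mul0r.
rewrite (@dsum_single _ _ _ I J.+1 (if J.+1 == N then xpow R (-1) else 1) 1); last 2 first.
- move=> i' r; rewrite vartheta_xm_entry mulr1 IJ eq_sym.
  by case: (eqVneq i' (ordS J)).
- by rewrite IJ /= modn_mod.
move: (IJ) => /eqP; rewrite (ordS_eq_digits m_gt0) => /andP[/eqP lI /eqP hI].
rewrite [i == lo I]eq_sym; case: (eqVneq (lo I) i) => [Ii|_] /=; last first.
  by rewrite !rmorph0 mxE rmorph0.
have iJ : i = ordS (lo J) by rewrite -Ii.
rewrite -iJ eqxx rmorph1 mulr1 (succ_max_digits iJ) (succ_digits iJ).
move: hI; rewrite Ii /top_digit; case: (eqVneq (i : nat) 0%N) => i0 hI /=; last first.
  by rewrite level_ups_qDpow hI eqxx rmorph1 mul1r.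
rewrite rmorphM (ups_Dpow ups_D) (ups_ZpowN1 ups_Z) mxE.
rewrite (bigD1 (hi J)) //= big1 ?addr0; last first.
  by move=> s; rewrite [X in _ * X]mxE => /negPf ->; rewrite mulr0.
rewrite !mxE eqxx hI eqxx levelM level_dexp0; congr (_ * _).
by case: ifP => _; rewrite ?level_cin ?rmorph1.
Qed.

Lemma image_xi p (i : 'I_m) k (I J : 'I_N) :
  level p (image (Uh i k) I J)
  = dsum p k i (fun i' r => (vartheta_val R (Yxi i' r)).1 I J).
Proof.
rewrite (mflatE m_gt0) mxE theta_h_entry.
have [IJ|IJ] := eqVneq I J; last first.
  rewrite dsum_eq0; last by move=> i' r; rewrite vartheta_xi_entry (negPf IJ).
  move: IJ; rewrite (lo_hi_inj m_gt0); case: (eqVneq (lo I) (lo J)) => [_|_]; last first.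
    by rewrite !rmorph0 mxE rmorph0.
  rewrite andTb => /negPf hIJ; rewrite rmorphB !mxE rmorphB /=.
  have z0 (z : nat) (z' : int) (c : bool) :
      level p (ups (if c then qDpow (m%:Z - z%:Z) z' else 0) (hi I) (hi J)) = 0.
    by case: c; rewrite ?rmorph0 ?mxE ?rmorph0 // level_ups_qDpow hIJ.
  rewrite z0 subr0; case: eqP => _; last by rewrite rmorph0 mxE rmorph0.
  case: eqP => _; last by rewrite level_ups_qDpow hIJ.
  by rewrite (ups_Dpow ups_D) mxE hIJ rmorph0.
rewrite -IJ eqxx.
(* The two vertices [ordS I] and [I] coincide when [N = 1], so the entry is split as a difference
   and each term is summed separately. *)
rewrite (_ : (fun i' r => _) = fun i' r =>
    (if i' == ordS I then 1 * dshift R N I.+1 r * 1 else 0)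
    - (if i' == I then 1 * dshift R N I r * 1 else 0)); last first.
  apply/funext => i'; apply/funext => r.
  by rewrite vartheta_xi_entry eqxx !mulr1 !mul1r.
rewrite dsumB (@dsum_single _ _ _ (ordS I) I.+1 1 1) //; last by rewrite /= modn_mod.
rewrite (@dsum_single _ _ _ I I 1 1) // rmorph1 !mulr1 !mul1r (lo_ordS m_gt0).
rewrite rmorphB !mxE rmorphB /=; congr (_ - _); last first.
  case: eqP => [->|_]; last by rewrite rmorph0 mxE rmorph0.
  by rewrite level_ups_qDpow eqxx -hi_lo.
case: eqP => [iI|_]; last by rewrite rmorph0 mxE rmorph0.
rewrite (succ_digits iI) /top_digit; case: eqP => i0; last first.
  by rewrite level_ups_qDpow eqxx.
by rewrite (ups_Dpow ups_D) mxE eqxx level_dexp0.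
Qed.

End Compare.

(** * Comparison on the generators *)

Section Envelope.
Variables (R : realType) (A : calgType (Ch R)) (N : nat).
Variable phi : 'M[A]_N -> 'M[A]_N -> Ch1 R.

Lemma env_hbar2_eq0 : csc hbar2 = 0 :> env phi.
Proof. exact: (pres_rel (env_hbar2 phi)). Qed.

Lemma env_inD x y : env_in phi (x + y) = env_in phi x + env_in phi y.
Proof.
apply/eqP; rewrite -subr_eq0 opprD addrA; apply/eqP.
by have := pres_rel (env_add phi x y); rewrite !rmorphB.
Qed.

Lemma env_inZ s x : env_in phi (cext_scale s x) = csc s * env_in phi x.
Proof.
apply/eqP; rewrite -subr_eq0; apply/eqP.
by have := pres_rel (env_scale phi s x); rewrite rmorphB rmorphM.
Qed.

Lemma env_in0 : env_in phi 0 = 0.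
Proof. by apply: (addrI (env_in phi 0)); rewrite -env_inD !addr0. Qed.

Lemma env_in_sum (I : Type) (r : seq I) (P : pred I) F :
  env_in phi (\sum_(i <- r | P i) F i) = \sum_(i <- r | P i) env_in phi (F i).
Proof. exact: (big_morph _ env_inD env_in0). Qed.

Lemma cext_sum (I : Type) (r : seq I) (P : pred I) (F : I -> cext A N) :
  \sum_(i <- r | P i) F i = (\sum_(i <- r | P i) (F i).1, \sum_(i <- r | P i) (F i).2).
Proof. by elim/big_rec3: _ => // i x y z _ ->. Qed.

End Envelope.

Section Scalars.
Variables (R : realType) (m n : nat) (ko : int).
Hypotheses (m_gt0 : (0 < m)%N) (n_gt0 : (0 < n)%N).
Local Notation omega := (omega R m n ko).
Local Notation N := (m * n)%N.

(* the image of [vartheta (Phi x)], truncated at order [p] *)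
Definition ztrunc (p : nat) (x : Ugen m) : cext (dop R) N :=
  \sum_(i' < N | i' == Ugen_vertex x %[mod m])
    cext_scale (cC (omega ^ (- (Ugen_mode x * i'%:Z))))
    (\sum_(r < p.+1) cext_scale (cC (((Ugen_mode x)%:~R * n%:R) ^+ r / (r`!)%:R))
                                (vartheta_val R (Ygen_over x i' r))).

Lemma ztrunc_fst p x I J : qpi (ideal_pow (@dop_J R) p) ((ztrunc p x).1 I J)
  = dsum ko p (Ugen_mode x) (Ugen_vertex x)
      (fun i' r => (vartheta_val R (Ygen_over x i' r)).1 I J).
Proof.
rewrite /ztrunc cext_sum /= summxE rmorph_sum; apply: eq_bigr => i' _.
rewrite mxE rmorphM /= qpi_csc; congr (_ * _).
rewrite cext_sum /= summxE rmorph_sum; apply: eq_bigr => r _.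
by rewrite mxE rmorphM /= qpi_csc.
Qed.

Lemma fcst1 : fcst 1 = 1 :> Ch1 R.
Proof. exact: rmorph1. Qed.

(** Among the Yangian generators only [xi_{0,0}] has a central part. It occurs at [i' = 0], [r = 0],
    where both coefficients are 1, whatever the mode; this matches the central term of [h_{0,k}]. *)
Lemma ztrunc_snd p x : (ztrunc p x).2 = (theta_val R n ko x).2.
Proof.
have v0 b i k : (\sum_(i' < N | i' == i %[mod m])
    cext_scale (cC (omega ^ (- (k * i'%:Z))))
    (\sum_(r < p.+1) cext_scale (cC ((k%:~R * n%:R) ^+ r / (r`!)%:R))
                                (vartheta_val R (Yx b i' r)))).2 = 0.
  rewrite cext_sum /= big1 // => i' _; rewrite cext_sum /= big1 ?mulr0 // => r _.
  by case: b => /=; case: ifP => _ /=; rewrite mulr0.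
case: x => i k.
- by rewrite [LHS](v0 true i k) /=; case: ifP.
- by rewrite [LHS](v0 false i k) /=; case: ifP.
have N_gt0 : (0 < N)%N by rewrite muln_gt0 m_gt0.
rewrite /ztrunc cext_sum /= big_mkcond (bigD1 (Ordinal N_gt0)) //=.
rewrite [X in _ + X]big1 ?addr0; last first.
  move=> i' i'0; case: ifP => // _; rewrite cext_sum /= big1 ?mulr0 // => r _.
  by rewrite (negPf i'0 : (i' == 0%N :> nat) = false) /= subr0 mulr0.
rewrite mulr0 oppr0 expr0z fcst1 mul1r cext_sum /= big_ord_recl big1 ?addr0; last first.
  by move=> r _; rewrite /= addr0 subr0 mulr0.
rewrite /= expr0 divr1 fcst1 mul1r mod0n modn_small ?ltn_ord // eq_sym.
by case: eqP => _ /=; rewrite !subr0 ?add0r.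
Qed.

End Scalars.

Lemma cext_split (R : realType) (A : calgType (Ch R)) N (M : 'M[A]_N) (s : Ch1 R) :
  (M, s) = cmat M + cext_scale (fcst s) (ccentral A N).
Proof.
apply: injective_projections => /=; last by rewrite add0r mulr1.
by apply/matrixP => i j; rewrite !mxE mulr0 addr0.
Qed.

Section UpsilonOnGenerators.
Variables (R : realType) (m n : nat) (ko : int).
Hypotheses (m_gt0 : (0 < m)%N) (n_gt0 : (0 < n)%N).
Local Notation N := (m * n)%N.
Variable phid : 'M[diffop R m n ko]_m -> 'M[diffop R m n ko]_m -> Ch1 R.
Variable phiD : 'M[dop R]_N -> 'M[dop R]_N -> Ch1 R.
Variable Ups : cext (diffop_hat R m n ko) m -> cext (dop_hat R) N.
Hypothesis UpsP : is_Upsilon phid phiD Ups.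
Variable UUps : {rmorphism env phid -> UD_hat phiD}.
Hypothesis UUpsP : is_U_Upsilon Ups UUps.

(** [is_env_hat_in] accepts any matrix that approximates the image at level [p]; the matrix of
    [ztrunc] does, by the comparison of entries. *)
Lemma level_UUps p (x : Ugen m) :
  level p (UUps (env_in phid (theta_val R n ko x)))
  = qpi _ (env_in phiD (ztrunc R n ko p x)).
Proof.
case: UpsP => [[UpsD UpsZ _] Upsc [ups [ups_csc ups_D ups_Z Upsmx]]].
have UpsE (M : 'M_m) (s : Ch1 R) : Ups (map_mx (@cin _ _) M, s) = (mflat (map_mx ups M), s).
  by rewrite cext_split UpsD UpsZ Upsc Upsmx -cext_split.
have := UUpsP.2 (theta_val R n ko x).1 (theta_val R n ko x).2.
rewrite UpsE -surjective_pairing => h; rewrite /level (h p (ztrunc R n ko p x).1) /=.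
  by rewrite -(ztrunc_snd R ko m_gt0 n_gt0 p x) -surjective_pairing.
move=> I J; rewrite ztrunc_fst.
case: x {h} => i k.
- exact: (image_xp m_gt0 n_gt0 ups_csc ups_D ups_Z).
- exact: (image_xm m_gt0 n_gt0 ups_csc ups_D ups_Z).
- exact: (image_xi m_gt0 n_gt0 ups_csc ups_D).
Qed.

End UpsilonOnGenerators.

Section PhiOnGenerators.
Variables (R : realType) (m n : nat) (ko : int).
Hypotheses (m_gt0 : (0 < m)%N) (n_gt0 : (0 < n)%N).
Local Notation N := (m * n)%N.
Variable phiD : 'M[dop R]_N -> 'M[dop R]_N -> Ch1 R.
Variable vartheta : {rmorphism yangian0 R N -> env phiD}.
Hypothesis varthetaP : is_vartheta vartheta.
Variable vhat : {rmorphism yangian_hat0 R N -> UD_hat phiD}.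
Hypothesis vhatP : is_vartheta_hat vartheta vhat.

Definition vlevel p : yangian_hat R N -> quot (deg_ge (UDgen_val phiD) (@UDdeg N) p) :=
  level p \o vhat \o qpi _.
HB.instance Definition _ p := GRing.RMorphism.on (vlevel p).

Lemma vlevel_Phi_val p (x : Ugen m) :
  vlevel p (Phi_val R n ko x) = qpi _ (env_in phiD (ztrunc R n ko p x)).
Proof.
have h2 : csc hbar2 = 0 :> quot (deg_ge (UDgen_val phiD) (@UDdeg N) p).
  rewrite -qpi_csc env_hbar2_eq0; exact: rmorph0.
have Vcsc s : vlevel p (csc s) = csc s.
  by rewrite /vlevel /= (vhatP.1 s) level_csc.
(* If [y] vanishes at level [p], then 0 is an admissible approximation of it. *)
have Vlevel y : level p y = 0 -> vlevel p y = 0.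
  move=> y0; rewrite /vlevel /= /level (vhatP.2 y p 0) ?rmorph0 //.
have Vgen y : vlevel p (Yhat_gen R y) = qpi _ (env_in phiD (vartheta_val R y)).
  by rewrite /vlevel /= /level (vhatP.2 _ p (yangian_gen R y)) ?cproj_cin // -varthetaP.2.
rewrite (V_Phi_val ko m_gt0 n_gt0 h2 Vcsc Vlevel) /ztrunc env_in_sum rmorph_sum.
apply: eq_bigr => i' _; rewrite env_inZ rmorphM /= qpi_csc env_in_sum rmorph_sum.
congr (_ * _); apply: eq_bigr => r _.
by rewrite Vgen env_inZ [RHS]rmorphM /= qpi_csc.
Qed.

End PhiOnGenerators.

Theorem proposition3p2 (R : realType) (m n : nat) (k : int)
  (m_gt0 : (0 < m)%N) (n_gt0 : (0 < n)%N) (coprime_kn : coprime `|k|%N n)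
  (phid : 'M[diffop R m n k]_m -> 'M[diffop R m n k]_m -> Ch1 R)
  (phidP : is_diffop_cocycle phid)
  (phiD : 'M[dop R]_(m * n) -> 'M[dop R]_(m * n) -> Ch1 R)
  (phiDP : is_dop_cocycle phiD)
  (theta : {rmorphism toroidal0 R m n k -> env phid})
  (thetaP : is_theta theta)
  (vartheta : {rmorphism yangian0 R (m * n) -> env phiD})
  (varthetaP : is_vartheta vartheta)
  (vartheta_hat : {rmorphism yangian_hat0 R (m * n) -> UD_hat phiD})
  (vartheta_hatP : is_vartheta_hat vartheta vartheta_hat)
  (Phi : {rmorphism toroidal_hat theta -> yangian_hat R (m * n)})
  (PhiP : is_Phi Phi)
  (Upsilon : cext (diffop_hat R m n k) m -> cext (dop_hat R) (m * n))
  (UpsilonP : is_Upsilon phid phiD Upsilon)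
  (U_Upsilon : {rmorphism env phid -> UD_hat phiD})
  (U_UpsilonP : is_U_Upsilon Upsilon U_Upsilon) :
  forall x : toroidal0 R m n k,
    vartheta_hat (Phi_bar Phi (toroidal0_hat theta x)) = U_Upsilon (theta x).
Proof.
have hbar1_level p : ideal_gen (deg_ge (UDgen_val phiD) (@UDdeg (m * n)) p) (csc (hbar1 ^+ p)).
  have := @ideal_gen_deg_ge _ _ _ (UDgen_val phiD) (@UDdeg (m * n)) p p 0 [::].
  by rewrite !big_nil expr0 !mulr1 !addn0; apply.
(* Both sides are pulled back to the completed free algebra, through the presentation and the
   reduction modulo [hbar_2]. *)
pose F : {rmorphism freeser R (Ugen m) -> UD_hat phiD} :=
  vartheta_hat \o qpi _ \o Phi \o cin _ \o qpi (closed_ideal (@Urel R m n k)).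
pose G : {rmorphism freeser R (Ugen m) -> UD_hat phiD} :=
  U_Upsilon \o theta \o qpi _ \o qpi (closed_ideal (@Urel R m n k)).
have FG : F =1 G.
  apply: (freeser_rmorph_ext (env_hbar2_eq0 phiD) hbar1_level) => [s|s|y].
  - by rewrite /F /= -[cin _ _]/(csc s : toroidal_hat theta) PhiP.1 qpi_csc vartheta_hatP.1.
  - by rewrite /G /= -[qpi _ _]/(csc s : toroidal0 R m n k) thetaP.1 U_UpsilonP.1.
  apply: level_inj => p.
  rewrite /F /G /= (PhiP.2 y) -[qpi _ (qpi _ _)]/(toroidal0_gen R n k y) (thetaP.2 y).
  rewrite (level_UUps m_gt0 n_gt0 UpsilonP U_UpsilonP).
  exact: (vlevel_Phi_val k m_gt0 n_gt0 varthetaP vartheta_hatP).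
(* Every [x] lifts to the free algebra. It remains to evaluate the two maps [qmap] on that lift,
   which is legitimate because they send [hbar_2] to [hbar_2]. *)
move=> x; rewrite -[x]qreprK -[qrepr x]qreprK.
rewrite -[RHS]/(G _) -FG /F /=; congr (vartheta_hat _).
rewrite /toroidal0_hat (@qmap_qpi _ _ _ _ (cin _)); last first.
  by move=> _ ->; exact: sub_ideal_gen.
rewrite /Phi_bar (@qmap_qpi _ _ _ _ Phi) // => _ ->.
by rewrite PhiP.1; exact: sub_ideal_gen.
Qed.
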